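(* Let $\mathbf{L}\in Q(\mathbb{B}^n)$. If an analytic function $F:\mathbb{B}^n\to\mathbb{C}$ has bounded $\mathbf{L}$-index in joint variables, then for any $R',R''\in\mathbb{R}^n_+$ with $0<|R'|<|R''|<\beta$ there exists a number $p_1=p_1(R',R'')\ge1$ such that for every $z^0\in\mathbb{B}^n$ $$M\left(\frac{R''}{\mathbf{L}(z^0)},z^0,F\right)\le p_1\,M\left(\frac{R'}{\mathbf{L}(z^0)},z^0,F\right).$$
   Context: $\mathbb{R}_+=[0,+\infty)$, $\mathbb{Z}_+=\{0,1,2,\dots\}$. $|\cdot|$ is the Euclidean norm on $\mathbb{C}^n$ (and on $\mathbb{R}^n$); $\mathbb{B}^n=\{z\in\mathbb{C}^n:|z|<1\}$. For $K\in\mathbb{Z}^n_+$: $\|K\|=k_1+\dots+k_n$, $K!=k_1!\cdots k_n!$, $A^K=a_1^{k_1}\cdots a_n^{k_n}$, and $F^{(K)}=\partial^{\|K\|}F/\partial z_1^{k_1}\cdots\partial z_n^{k_n}$. Quotients $A/B$ of vectors are componentwise. For $R=(r_1,\dots,r_n)\in\mathbb{R}^n_+$: $\mathbb{D}^n[z^0,R]=\{z:|z_j-z^0_j|\le r_j,\ j=1,\dots,n\}$, $\mathbb{T}^n(z^0,R)=\{z:|z_j-z^0_j|=r_j,\ j=1,\dots,n\}$, and $M(R,z^0,F)=\max\{|F(z)|:z\in\mathbb{T}^n(z^0,R)\}$. Fix a constant $\beta>\sqrt n$. Throughout, $\mathbf{L}(z)=(l_1(z),\dots,l_n(z))$, where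 each $l_j:\mathbb{B}^n\to\mathbb{R}_+$ is continuous and $l_j(z)>\beta/(1-|z|)$ for all $z\in\mathbb{B}^n$. (Then $\mathbb{D}^n[z^0,R/\mathbf{L}(z^0)]\subset\mathbb{B}^n$ whenever $z^0\in\mathbb{B}^n$, $|R|\le\beta$.) $Q(\mathbb{B}^n)$ is the class of such $\mathbf{L}$ satisfying, for all $R\in\mathbb{R}^n_+$ with $|R|\le\beta$ and all $j\in\{1,\dots,n\}$, $0<\lambda_{1,j}(R)\le\lambda_{2,j}(R)<\infty$, where $\lambda_{1,j}(R)$ and $\lambda_{2,j}(R)$ are respectively the infimum and the supremum of $l_j(z)/l_j(z^0)$ over all $z^0\in\mathbb{B}^n$ and $z\in\mathbb{D}^n[z^0,R/\mathbf{L}(z^0)]$. An analytic $F:\mathbb{B}^n\to\mathbb{C}$ is of bounded $\mathbf{L}$-index in joint variables if there is $m\in\mathbb{Z}_+$ such that for all $z\in\mathbb{B}^n$ and $J\in\mathbb{Z}^n_+$: $\frac{|F^{(J)}(z)|}{J!\mathbf{L}^J(z)}\le\max\{\frac{|F^{(K)}(z)|}{K!\mathbf{L}^K(z)}:K\in\mathbb{Z}^n_+,\|K\|\le m\}$.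
   Formalization: Every coordinate of R' is assumed strictly positive (R'' stays in R_+^n); otherwise the claim fails for n≥2: F(z)=z_1, l_j=2β/(1-|z|), z^0=0, R'=(0,t,0,...), R''=(s,0,...), 0<t<s<β gives M(R'/L)=0<M(R''/L). *)

(* Defs.v *)
From HB Require Import structures.
From mathcomp Require Import all_boot all_order all_algebra.
From mathcomp Require Import finmap complex.
From mathcomp Require Import all_classical all_reals all_analysis.
From mathcomp.analysis Require showcase.summability.

Set Implicit Arguments.
Unset Strict Implicit.
Unset Printing Implicit Defensive.

Import Order.TTheory GRing.Theory Num.Theory.
Import numFieldNormedType.Exports.
Import ComplexField.Normc.

Local Open Scope classical_set_scope.
Local Open Scope ring_scope.

(* The library puts no topology on R[i]; this is the one given by the modulus,
   with R[i] normed over itself, so that 'D_v below is a complex derivative. *)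
HB.instance Definition _ (R : realType) := NormedModule.copy R[i] R[i]^o.

Section Defs.
Context {R : realType} {n : nat}.
Local Notation C := R[i].
Implicit Types (z : 'rV[C]_n) (r : 'rV[R]_n) (F : 'rV[C]_n -> C).
Implicit Types (L : 'rV[C]_n -> 'rV[R]_n) (m : nat).

Definition vnorm (r : 'rV[R]_n) : R := Num.sqrt (\sum_(j < n) r 0 j ^+ 2).

Definition cvnorm (z : 'rV[C]_n) : R :=
  Num.sqrt (\sum_(j < n) normc (z 0 j) ^+ 2).

Definition unit_ball : set 'rV[C]_n := [set z | cvnorm z < 1].

Definition nonneg_vec (r : 'rV[R]_n) : Prop := forall j, 0 <= r 0 j.

Definition vdiv (r s : 'rV[R]_n) : 'rV[R]_n := \row_j (r 0 j / s 0 j).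

Definition polydisc (z0 : 'rV[C]_n) r : set 'rV[C]_n :=
  [set z | forall j, normc (z 0 j - z0 0 j) <= r 0 j].

Definition torus (z0 : 'rV[C]_n) r : set 'rV[C]_n :=
  [set z | forall j, normc (z 0 j - z0 0 j) = r 0 j].

(* The supremum is a maximum whenever F is continuous on the torus, which is
   nonempty (for r >= 0) and compact. *)
Definition max_torus r (z0 : 'rV[C]_n) F : R := sup [set normc (F z) | z in torus z0 r].

Definition midx := {ffun 'I_n -> nat}.

Definition mdeg (K : midx) : nat := (\sum_(j < n) K j)%N.
Definition mfact (K : midx) : nat := (\prod_(j < n) (K j)`!)%N.
Definition mpow (A : comNzRingType) (a : 'rV[A]_n) (K : midx) : A :=
  \prod_(j < n) a 0 j ^+ K j.

Definition partial (j : 'I_n) F : 'rV[C]_n -> C :=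
  fun z => 'D_(delta_mx 0 j : 'rV[C]_n) F z.

(* d^||K|| F / dz_1^{k_1} ... dz_n^{k_n}: the last variable is differentiated
   first. *)
Definition mpartial (K : midx) F : 'rV[C]_n -> C :=
  foldr (fun j G => iter (K j) (partial j) G) F (enum 'I_n).

(* F is, near every point of the ball, the sum of a power series; the
   convergence over multi-indices is unconditional (along finite sets), i.e.
   absolute. Values of F outside the ball are irrelevant. *)
Definition analytic_on_ball F : Prop :=
  forall z0, unit_ball z0 -> exists c : midx -> C, \forall z \near z0,
    summability.partial_sum (fun K => c K * mpow (z - z0) K)
      @ summability.totally --> F z.

Definition lratios L (j : 'I_n) r : set (\bar R) :=
  [set q | exists z0 z, [/\ unit_ball z0, polydisc z0 (vdiv r (L z0)) z
                          & q = (L z 0 j / L z0 0 j)%:E]].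

Definition lambda1 L j r : \bar R := ereal_inf (lratios L j r).
Definition lambda2 L j r : \bar R := ereal_sup (lratios L j r).

Definition admissible (beta : R) L : Prop :=
  forall j, {within unit_ball, continuous (fun z => L z 0 j)} /\
    forall z, unit_ball z -> beta / (1 - cvnorm z) < L z 0 j.

Definition classQ (beta : R) L : Prop :=
  admissible beta L /\
  forall r, nonneg_vec r -> vnorm r <= beta -> forall j,
    [/\ (0 < lambda1 L j r)%E, (lambda1 L j r <= lambda2 L j r)%E
      & (lambda2 L j r < +oo)%E].

Definition index_term L F (K : midx) z : R :=
  normc (mpartial K F z) / ((mfact K)%:R * mpow (L z) K).

Definition midx_of m (K : {ffun 'I_n -> 'I_m.+1}) : midx :=
  [ffun j => K j : nat].

(* If ||K|| <= m then every k_j <= m, so the maximum ranges over a finite type;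
   its unit 0 is harmless because the terms are nonnegative on the ball. *)
Definition bounded_index L F : Prop :=
  exists m, forall z, unit_ball z -> forall J : midx,
    index_term L F J z <=
      \big[Num.max/0]_(K : {ffun 'I_n -> 'I_m.+1} | (mdeg (midx_of K) <= m)%N)
        index_term L F (midx_of K) z.

End Defs.

Arguments midx : clear implicits.

(* Main.v *)
Require Import Defs.
From mathcomp Require Import all_boot all_order all_algebra.
From mathcomp Require Import finmap complex.
From mathcomp Require Import all_classical all_reals all_analysis.
From mathcomp Require Import ring lra.
From mathcomp.analysis Require showcase.summability.
Import Order.TTheory GRing.Theory Num.Theory.
Import numFieldNormedType.Exports.
Import ComplexField.Normc.

Set Implicit Arguments.
Unset Strict Implicit.
Unset Printing Implicit Defensive.

Local Open Scope classical_set_scope.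
Local Open Scope ring_scope.
Local Open Scope complex_scope.

(** Fix z0 in the ball and normalize every derivative by the weights at the
    centre: u_K = F^(K) / L(z0)^K ([nderiv]), with size
    N(z) = (sum over ||K|| <= m of |u_K(z)|^2)^(1/2) ([nsize]), where m is a bound
    for the index of F. The maximum over the R''/L(z0)-torus is compared with N(z0),
    and N(z0) with the maximum over the R'/L(z0)-torus; all constants depend on R',
    R'', L and F only, not on z0.

    From above. On the polydisc of polyradius R/L(z0) the weights L(z) and L(z0)
    are comparable because L belongs to the class Q, so boundedness of the index
    says that |u_J(z)| <= A N(z) for every ||J|| <= m + 1 ([nderiv_bound]). Moving one
    coordinate at a time, the functions u_K with ||K|| <= m therefore satisfy a
    linear differential inequality, and Gronwall's inequality gives
    |F(z)| <= N(z) <= E N(z0) on the polydisc ([nsize_polydisc]).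

    From below. A Landau inequality controls a first derivative by the function
    and, with arbitrarily small weight, by the second derivative. Since all the
    derivatives up to order m + 1 are at most A E N(z0), induction on the order gives
    |u_K(z0)| <= D sup |F| + eps N(z0) for ||K|| <= m, the supremum being over the
    R'/L(z0)-polydisc ([interpolation]); for small eps the last term is absorbed
    ([nsize_center_le]). The maximum principle replaces the polydisc by its torus
    ([maximum_modulus_torus]).

    The complex analysis behind this is elementary. The maximum principle for a disc
    follows from second-order Taylor expansions, by averaging over the four points
    p + s, p - s, p + is, p - is ([maximum_modulus_disc]).
    Applied to polynomials in one variable it yields Schwarz-type bounds for their
    Taylor coefficients ([poly_taylor_bounds]). An analytic function is, near every
    point, a pointwise limit of uniformly bounded polynomials, the finite partial
    sums of its series; the polynomial bounds pass to the limit, so that F has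
    partial derivatives of all orders, which commute and have quadratic Taylor
    remainders ([poly_limit_taylor1], [partial_mpartial_poly_limit]). *)

Local Notation Re := (@complex.Re _).
Local Notation Im := (@complex.Im _).

#[local] Existing Instance summability.totally_filter.

(** * The complex modulus and the maximum principle on a disc *)

Section Modulus.
Context {R : realType}.
Implicit Types (x y z : R[i]).

Lemma normc_ge0 x : 0 <= normc x.
Proof. by case: x => a b; exact: sqrtr_ge0. Qed.

Lemma normc_sub x y : normc (x - y) = normc (y - x).
Proof. by rewrite -normcN opprB. Qed.

Lemma le_normcB x y : normc (x - y) <= normc x + normc y.
Proof. by rewrite -[normc y]normcN; exact: le_normcD. Qed.

Lemma normc_real (r : R) : normc r%:C = `|r|.
Proof. by rewrite /= expr0n addr0 sqrtr_sqr. Qed.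

Lemma normcX x k : normc (x ^+ k) = normc x ^+ k.
Proof.
elim: k => [|k IH]; first by rewrite !expr0 normc1.
by rewrite !exprS normcM IH.
Qed.

Lemma sqr_normc_ReIm x : normc x ^+ 2 = Re x ^+ 2 + Im x ^+ 2.
Proof. by case: x => a b /=; rewrite sqr_sqrtr ?addr_ge0 ?sqr_ge0. Qed.

Lemma normr_Re_le x : `|Re x| <= normc x.
Proof.
by rewrite -(ler_pXn2r (ltn0Sn 1)) ?nnegrE ?normc_ge0 // real_normK ?num_real //
  sqr_normc_ReIm lerDl sqr_ge0.
Qed.

Lemma normr_Im_le x : `|Im x| <= normc x.
Proof.
by rewrite -(ler_pXn2r (ltn0Sn 1)) ?nnegrE ?normc_ge0 // real_normK ?num_real //
  sqr_normc_ReIm lerDr sqr_ge0.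
Qed.

Lemma normc_le_ReIm x : normc x <= `|Re x| + `|Im x|.
Proof.
rewrite -(ler_pXn2r (ltn0Sn 1)) ?nnegrE ?normc_ge0 ?addr_ge0 //.
rewrite sqr_normc_ReIm sqrrD !real_normK ?num_real // addrAC lerDl.
by rewrite mulrn_wge0 // mulr_ge0.
Qed.

Lemma normr_normcB x y : `|normc x - normc y| <= normc (x - y).
Proof.
rewrite ler_norml; apply/andP; split.
  rewrite lerNl opprB lerBlDr normc_sub.
  by rewrite -{1}[y](subrK x) le_normcD.
by rewrite lerBlDr -{1}[x](subrK y) le_normcD.
Qed.

End Modulus.

Section MaximumModulus.
Context {R : realType}.
Local Notation C := R[i].

(** The regularity behind the maximum principle; a cubic remainder instead of
    o(|w|^2) keeps the constants explicit. *)
Definition taylor2 (f : C -> C) (p : C) : Prop :=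
  exists a b : C, exists K s : R, 0 < s /\ forall w, normc w <= s ->
    normc (f (p + w) - (f p + a * w + b * w ^+ 2)) <= K * normc w ^+ 3.

Lemma taylor2_lip f p : taylor2 f p -> exists K s : R,
  [/\ 0 < s, 0 <= K & forall w, normc w <= s -> normc (f (p + w) - f p) <= K * normc w].
Proof.
move=> [a [b [K [s [s0 H]]]]].
exists (normc a + normc b + `|K|), (Num.min s 1); split.
- by rewrite lt_min s0 ltr01.
- by rewrite !addr_ge0 ?normc_ge0.
move=> w; rewrite le_min => /andP[ws w1].
have -> : f (p + w) - f p =
    (f (p + w) - (f p + a * w + b * w ^+ 2)) + (a * w + b * w ^+ 2) by ring.
apply: le_trans (le_normcD _ _) _.
have := H _ ws; move: (le_normcD (a * w) (b * w ^+ 2)).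
rewrite (normcM a) (normcM b) normcX.
have w0 := normc_ge0 w.
have : normc w ^+ 2 <= normc w by rewrite expr2 ler_piMr.
have : normc w ^+ 3 <= normc w by rewrite exprS ler_piMr // exprn_ile1.
have := ler_norm K.
have := normc_ge0 b.
have := normr_ge0 K.
have : 0 <= normc w ^+ 3 by rewrite exprn_ge0.
move: (normc _) (normc _) (normc a) (normc b) (normc w) => A B Ca Cb W; nra.
Qed.

Lemma normc_sum4 (x1 x2 x3 x4 : C) :
  normc (x1 + x2 + x3 + x4) <= normc x1 + normc x2 + normc x3 + normc x4.
Proof.
apply: le_trans (le_normcD _ _) _; rewrite lerD2r.
by apply: le_trans (le_normcD _ _) _; rewrite lerD2r le_normcD.
Qed.

(** The terms of orders one and two cancel in the sum of f over p + s, p - s, p + is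
    and p - is, so |f(p)| exceeds the mean of |f| over these points by O(s^3) at most,
    while the mean of |.|^2 exceeds |p|^2 by s^2. *)
Lemma no_interior_max f (p : C) (e s0 : R) : 0 < e -> 0 < s0 -> taylor2 f p ->
  ~ (forall w, normc w <= s0 ->
       normc (f (p + w)) + e * normc (p + w) ^+ 2 <= normc (f p) + e * normc p ^+ 2).
Proof.
move=> e0 s00 [a [b [K [s1 [s10 H]]]]] mx.
pose s := Num.min (Num.min s0 s1) (e / (2 * (`|K| + 1))).
have K1 : 0 < `|K| + 1 by rewrite ltr_pwDr.
have sp : 0 < s by rewrite !lt_min s00 s10 divr_gt0 // mulr_gt0.
have ss0 : s <= s0 by rewrite !ge_min lexx.
have ss1 : s <= s1 by rewrite !ge_min lexx orbT.
have sK : s * (`|K| + 1) <= e / 2.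
  rewrite -ler_pdivlMr //; rewrite ge_min; apply/orP; right.
  by rewrite invfM mulrA.
pose S : C := s%:C; pose T : C := 0 +i* s.
have nS : normc S = s by rewrite normc_real gtr0_norm.
have nT : normc T = s by rewrite /= expr0n add0r sqrtr_sqr gtr0_norm.
have T2 : T ^+ 2 = - S ^+ 2 by rewrite !expr2; simpc.
have Hw w : normc w = s -> normc (f (p + w) - (f p + a * w + b * w ^+ 2)) <= K * s ^+ 3.
  by move=> nw; have := H w; rewrite nw; apply.
have Mw w : normc w = s ->
    normc (f (p + w)) + e * normc (p + w) ^+ 2 <= normc (f p) + e * normc p ^+ 2.
  by move=> nw; apply: mx; rewrite nw.
have nNS : normc (- S) = s by rewrite normcN.
have nNT : normc (- T) = s by rewrite normcN.
have HS := Hw _ nS; have HNS := Hw _ nNS; have HT := Hw _ nT; have HNT := Hw _ nNT.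
have MS := Mw _ nS; have MNS := Mw _ nNS; have MT := Mw _ nT; have MNT := Mw _ nNT.
(* The four remainders are what is left of the four Taylor expansions. *)
have E4 : 4 * f p = f (p + S) + f (p - S) + f (p + T) + f (p - T) +
   - ((f (p + S) - (f p + a * S + b * S ^+ 2))
   + (f (p - S) - (f p + a * (- S) + b * (- S) ^+ 2))
   + (f (p + T) - (f p + a * T + b * T ^+ 2))
   + (f (p - T) - (f p + a * (- T) + b * (- T) ^+ 2))).
  by rewrite !sqrrN T2; ring.
have N4 : 4 * normc (f p) <= normc (f (p + S)) + normc (f (p - S)) + normc (f (p + T))
    + normc (f (p - T)) + 4 * (K * s ^+ 3).
  have -> : 4 * normc (f p) = normc (4 * f p).
    by rewrite normcM -[4 in RHS](rmorph_nat (real_complex R)) normc_real normr_nat.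
  rewrite E4; apply: le_trans (le_normcD _ _) _; rewrite normcN.
  apply: lerD (normc_sum4 _ _ _ _) _; apply: le_trans (normc_sum4 _ _ _ _) _.
  lra.
have P4 (q : C) : normc (q + S) ^+ 2 + normc (q - S) ^+ 2 + normc (q + T) ^+ 2 + normc (q - T) ^+ 2
    = 4 * normc q ^+ 2 + 4 * s ^+ 2.
  by rewrite !sqr_normc_ReIm /S /T; case: q => x y /=; ring.
have : e * (normc (p + S) ^+ 2 + normc (p - S) ^+ 2 + normc (p + T) ^+ 2 + normc (p - T) ^+ 2)
   <= 4 * e * normc p ^+ 2 + 4 * (K * s ^+ 3) by lra.
rewrite P4 => bad.
have {}bad : e * s ^+ 2 <= (K * s) * s ^+ 2 by rewrite -mulrA -exprS; lra.
have : e <= K * s by rewrite -(ler_pM2r (exprn_gt0 2 sp)).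
have : K * s <= s * (`|K| + 1).
  by rewrite mulrC ler_pM2l // (le_trans (ler_norm K)) // lerDl.
lra.
Qed.

Lemma continuous_modulus (f : C -> C) (e : R) (q : R * R) :
  taylor2 f (q.1 +i* q.2) ->
  {for q, continuous (fun v : R * R =>
     normc (f (v.1 +i* v.2)) + e * (v.1 ^+ 2 + v.2 ^+ 2))}.
Proof.
move=> /taylor2_lip[K [s [s0 K0 lip]]].
apply: cvgD; last first.
  apply: cvgM; first exact: cvg_cst.
  by apply: cvgD; rewrite !expr2; apply: cvgM; (exact: cvg_fst || exact: cvg_snd).
apply/cvgrPdist_lt => d d0.
have D0 : 0 < Num.min s (d / (K + 1)) by rewrite lt_min s0 divr_gt0 // ltr_wpDl.
have D1 : 0 < Num.min s (d / (K + 1)) / 2 by rewrite divr_gt0.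
have n1 : \forall v \near q, `|v.1 - q.1| < Num.min s (d / (K + 1)) / 2.
  have /cvgrPdist_lt/(_ _ D1) : v.1 @[v --> q] --> q.1 by exact: cvg_fst.
  by apply: filterS => v; rewrite distrC; apply.
have n2 : \forall v \near q, `|v.2 - q.2| < Num.min s (d / (K + 1)) / 2.
  have /cvgrPdist_lt/(_ _ D1) : v.2 @[v --> q] --> q.2 by exact: cvg_snd.
  by apply: filterS => v; rewrite distrC; apply.
near=> v.
have h1 : `|v.1 - q.1| < Num.min s (d / (K + 1)) / 2 by near: v.
have h2 : `|v.2 - q.2| < Num.min s (d / (K + 1)) / 2 by near: v.
rewrite distrC; apply: le_lt_trans (normr_normcB _ _) _.
pose w : C := (v.1 - q.1) +i* (v.2 - q.2).
have -> : v.1 +i* v.2 = q.1 +i* q.2 + w by rewrite /w; simpc; congr (_ +i* _); ring.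
have nw : normc w < Num.min s (d / (K + 1)).
  by apply: le_lt_trans (normc_le_ReIm _) _; rewrite /w /=; lra.
apply: le_lt_trans (lip _ (ltW _)) _.
  by apply: lt_le_trans nw _; rewrite ge_min lexx.
have : normc w < d / (K + 1) by apply: lt_le_trans nw _; rewrite ge_min lexx orbT.
rewrite ltr_pdivlMr ?ltr_wpDl // => H.
by apply: le_lt_trans H; rewrite mulrC ler_wpM2l ?normc_ge0 // lerDl.
Unshelve. all: by end_near.
Qed.

Lemma compact_disc (r : R) : compact [set v : R * R | v.1 ^+ 2 + v.2 ^+ 2 <= r ^+ 2].
Proof.
apply: (@subclosed_compact _ _ (`[- `|r|, `|r|] `*` `[- `|r|, `|r|])).
- have -> : [set v : R * R | v.1 ^+ 2 + v.2 ^+ 2 <= r ^+ 2] =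
     (fun v => v.1 ^+ 2 + v.2 ^+ 2) @^-1` [set x | x <= r ^+ 2] by [].
  apply: preimage_closed; last exact: closed_le.
  by move=> v _; apply: cvgD; rewrite !expr2; apply: cvgM; (exact: cvg_fst || exact: cvg_snd).
- by apply: compact_setX; exact: segment_compact.
move=> v /= vr; split => /=; rewrite in_itv /= -ler_norml -(ler_pXn2r (ltn0Sn 1)) ?nnegrE //
  !real_normK ?num_real //; apply: le_trans vr; [rewrite lerDl|rewrite lerDr]; exact: sqr_ge0.
Qed.

(** The perturbed function |f| + e |.|^2 attains its maximum on the compact disc, and
    by [no_interior_max] on the boundary circle; let e tend to 0. *)
Theorem maximum_modulus_disc (f : C -> C) (r M : R) :
  (forall w, normc w <= r -> taylor2 f w) ->
  (forall w, normc w = r -> normc (f w) <= M) ->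
  forall w, normc w <= r -> normc (f w) <= M.
Proof.
move=> ft fM w wr.
have r0 : 0 <= r by apply: le_trans (normc_ge0 w) wr.
apply/ler_addgt0Pr => d d0.
pose e := d / (r ^+ 2 + 1).
have r1 : 0 < r ^+ 2 + 1 by rewrite ltr_wpDl ?sqr_ge0.
have e0 : 0 < e by rewrite divr_gt0.
pose h (v : R * R) := normc (f (v.1 +i* v.2)) + e * (v.1 ^+ 2 + v.2 ^+ 2).
have inD (v : R * R) : v.1 ^+ 2 + v.2 ^+ 2 <= r ^+ 2 -> normc (v.1 +i* v.2) <= r.
  by move=> vD; rewrite -(ler_pXn2r (ltn0Sn 1)) ?nnegrE ?normc_ge0 // sqr_normc_ReIm.
have [] := @compact_EVT_max _ _ h _ _ (@compact_disc r) _.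
- by exists (0, 0) => /=; rewrite expr0n /= addr0 sqr_ge0.
- apply: continuous_in_subspaceT => v /set_mem /= vD.
  by apply: continuous_modulus; apply: ft; exact: inD.
move=> c /set_mem/= cD cmax.
pose p := c.1 +i* c.2.
have hE z : h (complex.Re z, complex.Im z) = normc (f z) + e * normc z ^+ 2.
  by rewrite sqr_normc_ReIm /h /=; case: z.
have pr : normc p <= r by exact: inD.
have {}cmax z : normc z <= r -> normc (f z) + e * normc z ^+ 2 <= normc (f p) + e * normc p ^+ 2.
  move=> zr; rewrite -!hE; have -> : (Re p, Im p) = c by rewrite [RHS]surjective_pairing.
  by apply: cmax; rewrite inE /= -sqr_normc_ReIm ler_pXn2r ?nnegrE ?normc_ge0.
have pM : normc (f p) <= M.
  move: pr; rewrite le_eqVlt => /orP[/eqP|pr]; first exact: fM.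
  exfalso; apply: (@no_interior_max f p e (r - normc p) e0).
  - by rewrite subr_gt0.
  - by apply: ft; exact: ltW.
  - move=> u ur; apply: cmax; apply: le_trans (le_normcD _ _) _; lra.
have er : e * r ^+ 2 <= d.
  by rewrite /e mulrAC ler_pdivrMr // ler_pM2l // lerDl.
have : e * normc p ^+ 2 <= e * r ^+ 2 by rewrite ler_pM2l // ler_pXn2r ?nnegrE ?normc_ge0.
have : 0 <= e * normc w ^+ 2 by rewrite mulr_ge0 ?sqr_ge0 // ltW.
have := cmax _ wr.
lra.
Qed.

End MaximumModulus.

(** * Taylor coefficients of bounded polynomials in one variable *)

Section PolynomialTaylor.
Context {R : realType}.
Local Notation C := R[i].
Implicit Types (p q : {poly C}) (s B : R).

Lemma poly_splitX p : exists q, p = q * 'X + (p.[0])%:P.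
Proof.
elim/poly_ind: p => [|p c _]; first by exists 0; rewrite horner0 mul0r add0r.
by exists p; rewrite hornerMXaddC mulr0 add0r.
Qed.

Lemma poly_bounded_unit_disc p :
  exists B, forall w, normc w <= 1 -> normc p.[w] <= B.
Proof.
elim/poly_ind: p => [|p c [B IH]].
  by exists 0 => w _; rewrite horner0 normc0.
exists (B + normc c) => w w1; rewrite hornerMXaddC.
apply: le_trans (le_normcD _ _) _; rewrite lerD2r normcM.
apply: le_trans (IH _ w1); rewrite ler_piMr ?normc_ge0 //.
Qed.

Lemma taylor2_horner p x : taylor2 (horner p) x.
Proof.
have [q1 E1] := poly_splitX (p \Po ('X + x%:P)).
have [q2 E2] := poly_splitX q1.
have [q3 E3] := poly_splitX q2.
have [B HB] := poly_bounded_unit_disc q3.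
exists q1.[0], q2.[0], B, 1; split=> // w w1.
have px u : p.[x + u] = (p \Po ('X + x%:P)).[u].
  by rewrite horner_comp hornerD hornerX hornerC addrC.
have -> : p.[x] = p.[x + 0] by rewrite addr0.
rewrite !px {1}E1 {1}E2 {1}E3.
move: (_.[0]) => c0; rewrite !(hornerMXaddC, hornerC).
rewrite (_ : _ - _ = q3.[w] * w ^+ 3); last by ring.
by rewrite normcM normcX ler_wpM2r ?exprn_ge0 ?normc_ge0 ?HB.
Qed.

(** Schwarz's lemma: apply the maximum principle to the quotient. The factor 2 comes
    from subtracting the value at the centre. *)
Lemma poly_schwarz q c s B : 0 < s ->
  (forall w, normc w <= s -> normc (q * 'X + c%:P).[w] <= B) ->
  forall w, normc w <= s -> normc q.[w] <= 2 * B / s.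
Proof.
move=> s0 pB; apply: maximum_modulus_disc => [w _|w ws].
  exact: taylor2_horner.
rewrite ler_pdivlMr // -{1}ws -normcM.
have -> : q.[w] * w = (q * 'X + c%:P).[w] - (q * 'X + c%:P).[0].
  by rewrite !hornerMXaddC; ring.
apply: le_trans (le_normcB _ _) _.
have H0 := pB 0; rewrite normc0 in H0.
have := H0 (ltW s0); have := pB w; rewrite ws lexx => /(_ isT); lra.
Qed.

(** Dividing by the variable three times, each division preserving a bound on the
    disc. The constants depend on s and B only, not on the degree, and so survive a
    limit of polynomials. *)
Lemma poly_taylor_bounds p s B : 0 < s ->
  (forall w, normc w <= s -> normc p.[w] <= B) ->
  [/\ normc (deriv p).[0] <= 2 * B / s,
      (forall w, normc w <= s ->
         normc (p.[w] - p.[0] - w * (deriv p).[0]) <= 4 * B / s ^+ 2 * normc w ^+ 2) &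
      (forall w, normc w <= s ->
         normc (p.[w] - (p.[0] + w * (deriv p).[0] + w ^+ 2 / 2 * (deriv (deriv p)).[0]))
           <= 8 * B / s ^+ 3 * normc w ^+ 3)].
Proof.
move=> s0 pB.
have [q1 E1] := poly_splitX p.
have [q2 E2] := poly_splitX q1.
have [q3 E3] := poly_splitX q2.
have sn0 : s != 0 by rewrite gt_eqF.
have B1 : forall w, normc w <= s -> normc q1.[w] <= 2 * B / s.
  by rewrite E1 in pB; exact: (poly_schwarz s0 pB).
have B2 : forall w, normc w <= s -> normc q2.[w] <= 4 * B / s ^+ 2.
  rewrite (_ : 4 * B / s ^+ 2 = 2 * (2 * B / s) / s); last by field.
  by rewrite E2 in B1; exact: (poly_schwarz s0 B1).
have B3 : forall w, normc w <= s -> normc q3.[w] <= 8 * B / s ^+ 3.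
  rewrite (_ : 8 * B / s ^+ 3 = 2 * (4 * B / s ^+ 2) / s); last by field.
  by rewrite E3 in B2; exact: (poly_schwarz s0 B2).
have d1 : (deriv p).[0] = q1.[0].
  by rewrite E1 !poly.derivE !hornerE ?addr0.
have d2 : (deriv (deriv p)).[0] = 2 * q2.[0].
  rewrite E1 E2 !poly.derivE !hornerE /=; ring.
rewrite d1 d2; split.
- by apply: B1; rewrite normc0 ltW.
- move=> w ws.
  have -> : p.[w] - p.[0] - w * q1.[0] = q2.[w] * w ^+ 2.
    rewrite {1}E1 {1}E2; move: (p.[0]) (q1.[0]) => a b.
    by rewrite !(hornerMXaddC, hornerC); ring.
  by rewrite normcM normcX ler_wpM2r ?exprn_ge0 ?normc_ge0 ?B2.
- move=> w ws.
  have -> : p.[w] - (p.[0] + w * q1.[0] + w ^+ 2 / 2 * (2 * q2.[0])) = q3.[w] * w ^+ 3.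
    rewrite {1}E1 {1}E2 {1}E3; move: (p.[0]) (q1.[0]) (q2.[0]) => a b c.
    by rewrite !(hornerMXaddC, hornerC); field.
  by rewrite normcM normcX ler_wpM2r ?exprn_ge0 ?normc_ge0 ?B3.
Qed.

End PolynomialTaylor.

(** * Partial derivatives, limits, and polynomials in several variables *)

Section PartialDerivatives.
Context {R : realType} {n : nat}.
Local Notation C := R[i].
Implicit Types (z : 'rV[C]_n) (F G : 'rV[C]_n -> C) (j : 'I_n).

Definition shift_coord z j (w : C) : 'rV[C]_n := z + w *: delta_mx 0 j.

Lemma shift_coordE z j w i : shift_coord z j w 0 i = z 0 i + w * (i == j)%:R.
Proof. by rewrite !mxE eqxx eq_sym. Qed.

Lemma shift_coord0 z j : shift_coord z j 0 = z.
Proof. by rewrite /shift_coord scale0r addr0. Qed.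

Lemma shift_coordD z j w w' : shift_coord (shift_coord z j w) j w' = shift_coord z j (w + w').
Proof. by rewrite /shift_coord scalerDl addrA. Qed.

Lemma normCE (x : C) : `|x| = (normc x)%:C.
Proof. by []. Qed.

Lemma cvg_normcP (T : Type) (Phi : set_system T) (FF : Filter Phi) (u : T -> C) (l : C) :
  u x @[x --> Phi] --> l <->
  forall e : R, 0 < e -> \forall x \near Phi, normc (u x - l) <= e.
Proof.
split=> [/cvgrPdist_le H e e0|H].
  have e0' : (0 : C) < e%:C by rewrite ltcR.
  by apply: filterS (H _ e0') => x; rewrite normCE lecR normc_sub.
apply/cvgrPdist_le => -[e e']; rewrite ltcE /= => /andP[/eqP-> e0].
by apply: filterS (H _ e0) => x; rewrite normCE lecR normc_sub.
Qed.

Lemma partial_eq F z j (d : C) (K s : R) : 0 < s ->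
  (forall w, normc w <= s ->
     normc (F (shift_coord z j w) - F z - w * d) <= K * normc w ^+ 2) ->
  partial j F z = d.
Proof.
move=> s0 H; rewrite /partial /derive.
apply: cvg_lim; first exact: norm_hausdorff.
apply/cvg_normcP => e e0.
have K1 : 0 < `|K| + 1 by rewrite ltr_pwDr.
have d0 : 0 < Num.min s (e / (`|K| + 1)) by rewrite lt_min s0 divr_gt0.
have dC0 : (0 : C) < (Num.min s (e / (`|K| + 1)))%:C by rewrite ltcR.
near=> h.
have h0 : h != 0 by near: h; exact: nbhs_dnbhs_neq.
have : `|h| < (Num.min s (e / (`|K| + 1)))%:C by near: h; exact: dnbhs0_lt.
rewrite normCE ltcR lt_min => /andP[hs]; rewrite ltr_pdivlMr // => he.
have hh : 0 < normc h.
  by rewrite lt_def normc_ge0 andbT; apply: contra_neq h0; exact: eq0_normc.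
have stepE : h *: delta_mx 0 j + z = shift_coord z j h by rewrite addrC.
rewrite /= stepE.
have -> : h^-1 *: (F (shift_coord z j h) - F z) - d = h^-1 * (F (shift_coord z j h) - F z - h * d).
  by rewrite /GRing.scale /=; field.
rewrite normcM normcV mulrC ler_pdivrMr //.
apply: le_trans (H _ (ltW hs)) _; rewrite expr2 mulrA ler_pM2r //.
apply: le_trans (ltW he); rewrite mulrC ler_pM2l //.
by rewrite (le_trans (ler_norm K)) // lerDl.
Unshelve. all: by end_near.
Qed.

Lemma cvg_normc_le (T : Type) (Phi : set_system T) (FF : ProperFilter Phi)
    (u : T -> C) (l : C) (B : R) :
  u x @[x --> Phi] --> l -> (forall x, normc (u x) <= B) -> normc l <= B.
Proof.
move=> /cvg_normcP ul uB; apply/ler_addgt0Pr => e /ul /filter_ex[x ux].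
rewrite addrC; have -> : l = - (u x - l) + u x by ring.
by apply: le_trans (le_normcD _ _) _; rewrite normcN lerD.
Qed.

(** Completeness of the complex plane, obtained from that of the real line for the
    real and imaginary parts. *)
Lemma cvg_of_cauchy (T : Type) (Phi : set_system T) (FF : ProperFilter Phi)
    (u : T -> C) :
  (forall e : R, 0 < e -> exists c, \forall x \near Phi, normc (u x - c) <= e) ->
  exists l : C, u x @[x --> Phi] --> l.
Proof.
move=> H.
have cvgR (g : C -> R) : (forall x y, `|g x - g y| <= normc (x - y)) ->
    exists a : R, g (u x) @[x --> Phi] --> a.
  move=> glip; apply/cvg_ex; apply: cauchy_cvg; apply: cauchy_exP => e e0.
  have e20 : 0 < e / 2 by rewrite divr_gt0.
  have [c Hc] := H _ e20; exists (g c).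
  apply: filterS Hc => x ux; rewrite /ball /= distrC.
  by apply: le_lt_trans (glip _ _) _; apply: le_lt_trans ux _;
    rewrite ltr_pdivrMr // ltr_pMr // ltr1n.
have [a Ha] := cvgR Re (fun x y => ltac:(by rewrite -raddfB; exact: normr_Re_le)).
have [b Hb] := cvgR Im (fun x y => ltac:(by rewrite -raddfB; exact: normr_Im_le)).
exists (a +i* b); apply/cvg_normcP => e e0.
have e20 : 0 < e / 2 by rewrite divr_gt0.
move/cvgrPdist_le: Ha => /(_ _ e20) Ha; move/cvgrPdist_le: Hb => /(_ _ e20) Hb.
apply: filterS2 Ha Hb => x ha hb.
apply: le_trans (normc_le_ReIm _) _.
by move: ha hb; rewrite !raddfB /= distrC (distrC b); lra.
Qed.

(** Polynomials are kept as syntax trees: the formal derivative [pderiv] then recurses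
    on the tree, and mixed derivatives commute by structural induction. *)
Inductive pexp := Cst of C | Var of 'I_n | Add of pexp & pexp | Mul of pexp & pexp.

Fixpoint peval (e : pexp) z : C :=
  match e with
  | Cst c => c
  | Var i => z 0 i
  | Add a b => peval a z + peval b z
  | Mul a b => peval a z * peval b z
  end.

Fixpoint pderiv j (e : pexp) : pexp :=
  match e with
  | Cst c => Cst 0
  | Var i => Cst (i == j)%:R
  | Add a b => Add (pderiv j a) (pderiv j b)
  | Mul a b => Add (Mul (pderiv j a) b) (Mul a (pderiv j b))
  end.

Lemma pderivC i j e z : peval (pderiv i (pderiv j e)) z = peval (pderiv j (pderiv i e)) z.
Proof.
elim: e => //= [a -> b ->//|a IHa b IHb].
by rewrite IHa IHb; ring.
Qed.

(** Restricting to one coordinate reduces statements about [pexp] to univariate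
    polynomials; the derivatives are compared along with the values. *)
Lemma pexp_slice j e z : exists p : {poly C}, forall w,
  [/\ peval e (shift_coord z j w) = p.[w],
      peval (pderiv j e) (shift_coord z j w) = (deriv p).[w] &
      peval (pderiv j (pderiv j e)) (shift_coord z j w) = (deriv (deriv p)).[w]].
Proof.
elim: e => [c|i|a [p Hp] b [q Hq]|a [p Hp] b [q Hq]] /=.
- by exists c%:P => w; rewrite !poly.derivE !hornerE.
- exists ((z 0 i)%:P + (i == j)%:R *: 'X) => w.
  rewrite shift_coordE !(poly.derivD, poly.derivC, poly.derivZ, poly.derivX)
    alg_polyC scaler0 !add0r.
  by rewrite !(hornerD, hornerC, hornerZ, hornerX) mulrC.
- exists (p + q) => w; have [-> -> ->] := Hp w; have [-> -> ->] := Hq w.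
  by rewrite !poly.derivE !hornerE.
- exists (p * q) => w; have [-> -> ->] := Hp w; have [-> -> ->] := Hq w.
  by rewrite !poly.derivE !hornerE; split.
Qed.

Lemma partial_peval j e : partial j (peval e) = peval (pderiv j e).
Proof.
apply/funext => z; have [p Hp] := pexp_slice j e z.
have [B HB] := poly_bounded_unit_disc p.
have [_ H _] := poly_taylor_bounds ltr01 HB.
apply: (partial_eq ltr01) => w w1; have [-> _ _] := Hp w.
by have [-> -> _] : [/\ peval e z = p.[0], peval (pderiv j e) z = (deriv p).[0] & True];
  [have [] := Hp 0; rewrite shift_coord0|exact: H].
Qed.

End PartialDerivatives.

(** * Pointwise limits of uniformly bounded polynomials *)

Section LocalPolynomialLimits.
Context {R : realType} {n : nat}.
Context {T : Type} {Phi : set_system T} {FF : ProperFilter Phi}.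
Local Notation C := R[i].
Implicit Types (z : 'rV[C]_n) (F G : 'rV[C]_n -> C) (i j : 'I_n) (K : midx n).
Implicit Types (P : T -> 'rV[C]_n -> C).

(** Limit rules for nets written pointwise, the form in which the Taylor remainders
    below appear. *)
Lemma cvgD_pt (u v : T -> C) (a b : C) : u t @[t --> Phi] --> a ->
  v t @[t --> Phi] --> b -> (u t + v t) @[t --> Phi] --> a + b.
Proof. exact: cvgD. Qed.

Lemma cvgB_pt (u v : T -> C) (a b : C) : u t @[t --> Phi] --> a ->
  v t @[t --> Phi] --> b -> (u t - v t) @[t --> Phi] --> a - b.
Proof. exact: cvgB. Qed.

Lemma cvgMl_pt (c : C) (u : T -> C) (a : C) : u t @[t --> Phi] --> a ->
  (c * u t) @[t --> Phi] --> c * a.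
Proof. by move=> ua; apply: cvgM ua; exact: cvg_cst. Qed.

Definition polyfun G : Prop := exists e, G = peval e.

Lemma polyfun_partial j G : polyfun G -> polyfun (partial j G).
Proof. by move=> [e ->]; exists (pderiv j e); exact: partial_peval. Qed.

Lemma partialC i j G : polyfun G ->
  partial i (partial j G) = partial j (partial i G).
Proof.
by move=> [e ->]; rewrite !partial_peval; apply/funext => z; exact: pderivC.
Qed.

Definition incr_midx K j : midx n := [ffun i => (K i + (i == j))%N].

Lemma polyfun_iter_partial i k G : polyfun G -> polyfun (iter k (partial i) G).
Proof. move=> pG; elim: k => [//|k IH]; exact: polyfun_partial. Qed.

Lemma partial_iterC i j k G : polyfun G ->
  partial j (iter k (partial i) G) = iter k (partial i) (partial j G).
Proof.
move=> pG; elim: k => [//|k IH]; rewrite !iterS partialC; first by rewrite IH.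
exact: polyfun_iter_partial.
Qed.

(** The extra derivative is moved past those of the other variables to its place in
    the order in which [mpartial] differentiates. *)
Lemma partial_mpartial_polyfun j K G : polyfun G ->
  partial j (mpartial K G) = mpartial (incr_midx K j) G.
Proof.
rewrite /mpartial => pG.
have : j \in enum 'I_n by rewrite mem_enum.
have pD s : polyfun (foldr (fun i G => iter (K i) (partial i) G) G s).
  by elim: s => [//|i s IH]; exact: polyfun_iter_partial.
elim: (enum 'I_n) (enum_uniq 'I_n) => // i s IH /= /andP[is_ us].
rewrite inE ffunE => /orP[/eqP ji|js].
  subst j; rewrite eqxx addn1 /=; congr partial; congr iter.
  elim: s is_ {us IH} => [//|k s IH]; rewrite inE negb_or => /andP[ik ks].
  by rewrite /= -(IH ks) ffunE eq_sym (negbTE ik) addn0.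
have ij : i == j = false by apply/eqP => ij; rewrite ij js in is_.
by rewrite ij addn0 -(IH us js) partial_iterC.
Qed.

(** Near z0, F is the pointwise limit of the uniformly bounded polynomials P t. Pointwise
    convergence carries derivatives along because the bounds of [poly_taylor_bounds]
    are uniform in t. *)
Definition poly_limit F z0 (r : R) P : Prop :=
  [/\ 0 < r, (forall t, polyfun (P t)) &
   exists B : R, forall z, polydisc z0 (const_mx r) z ->
     (forall t, normc (P t z) <= B) /\ P t z @[t --> Phi] --> F z].

Lemma polydisc_shift_coord z0 z j w (r s : R) : polydisc z0 (const_mx r) z -> normc w <= s ->
  polydisc z0 (const_mx (r + s)) (shift_coord z j w).
Proof.
move=> zr ws i; rewrite shift_coordE mxE addrAC.
apply: le_trans (le_normcD _ _) _; apply: lerD; first by have := zr i; rewrite mxE.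
case: eqP => _; rewrite ?mulr1 // mulr0 normc0.
exact: le_trans (normc_ge0 w) ws.
Qed.

Lemma polydisc_center z0 (r : 'rV[R]_n) : (forall j, 0 <= r 0 j) -> polydisc z0 r z0.
Proof. by move=> r0 j; rewrite subrr normc0. Qed.

Lemma polydiscS z0 (r s : 'rV[R]_n) z : (forall j, r 0 j <= s 0 j) ->
  polydisc z0 r z -> polydisc z0 s z.
Proof. by move=> rs zr j; apply: le_trans (zr j) (rs j). Qed.

(** The difference quotients of the P t in direction j are within O(|w|) of the
    derivatives, uniformly in t, and they converge for each fixed w. Hence the
    derivatives of the P t form a Cauchy net, and the quadratic remainder estimate
    passes to the limit, which identifies the limit of the derivatives as the
    derivative of F. *)
Lemma poly_limit_taylor1 F z0 r P j : poly_limit F z0 r P ->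
  exists K B : R, forall z, polydisc z0 (const_mx (r / 2)) z ->
    [/\ forall t, normc (partial j (P t) z) <= B,
        partial j (P t) z @[t --> Phi] --> partial j F z &
        forall w, normc w <= r / 2 ->
          normc (F (shift_coord z j w) - F z - w * partial j F z) <= K * normc w ^+ 2].
Proof.
move=> [r0 pP [B HB]].
have r20 : 0 < r / 2 by rewrite divr_gt0.
pose Q := 4 * B / (r / 2) ^+ 2.
exists Q, (2 * B / (r / 2)) => z zr.
have zr' w : normc w <= r / 2 -> polydisc z0 (const_mx r) (shift_coord z j w).
  by rewrite [in const_mx r](splitr r); exact: polydisc_shift_coord.
have slice t : exists p : {poly C}, [/\ forall w, P t (shift_coord z j w) = p.[w],
    partial j (P t) z = (deriv p).[0] & P t z = p.[0]].
  have [e Pe] := pP t; rewrite Pe; have [p Hp] := pexp_slice j e z.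
  exists p; split=> [w||]; first by have [] := Hp w.
    by rewrite partial_peval; have [_] := Hp 0; rewrite shift_coord0.
  by have [+ _ _] := Hp 0; rewrite shift_coord0.
have bound t : normc (partial j (P t) z) <= 2 * B / (r / 2) /\
    forall w, normc w <= r / 2 ->
      normc (P t (shift_coord z j w) - P t z - w * partial j (P t) z) <= Q * normc w ^+ 2.
  have [p [Hp -> ->]] := slice t.
  have [|h1 h2 _] := @poly_taylor_bounds _ p (r / 2) B r20.
    by move=> w ws; rewrite -Hp; have [+ _] := HB _ (zr' _ ws); apply.
  by split=> // w ws; rewrite Hp; exact: h2.
have cv w : normc w <= r / 2 -> P t (shift_coord z j w) @[t --> Phi] --> F (shift_coord z j w).
  by move=> ws; have [] := HB _ (zr' _ ws).
have cv0 : P t z @[t --> Phi] --> F z.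
  by have := cv 0; rewrite shift_coord0 normc0; apply; exact: ltW.
have [d Hd] : exists d : C, partial j (P t) z @[t --> Phi] --> d.
  apply: cvg_of_cauchy => e e0.
  have Q1 : 0 < `|Q| + 1 by rewrite ltr_pwDr.
  pose s := Num.min (r / 2) (e / 2 / (`|Q| + 1)).
  have s0 : 0 < s by rewrite lt_min r20 !divr_gt0.
  have sr : s <= r / 2 by rewrite ge_min lexx.
  have sQ : s * (`|Q| + 1) <= e / 2.
    by rewrite -ler_pdivlMr //; rewrite ge_min lexx orbT.
  pose w : C := s%:C.
  have nw : normc w = s by rewrite normc_real gtr0_norm.
  have w0 : w != 0 by apply/eqP => w0; move: s0; rewrite -nw w0 normc0 ltxx.
  exists ((F (shift_coord z j w) - F z) / w).
  have ws : normc w <= r / 2 by rewrite nw.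
  have /cvg_normcP := cvgB_pt (cv w ws) cv0.
  move=> /(_ (s * (e / 2)) (mulr_gt0 s0 (divr_gt0 e0 (ltr0n _ 2)))).
  apply: filterS => t Ht.
  have [_ /(_ w ws)] := bound t; rewrite nw => Bt.
  rewrite -(ler_pM2l s0) -{1}nw -normcM.
  have -> : w * (partial j (P t) z - (F (shift_coord z j w) - F z) / w) =
    (P t (shift_coord z j w) - P t z - (F (shift_coord z j w) - F z)) -
    (P t (shift_coord z j w) - P t z - w * partial j (P t) z).
    by field.
  apply: le_trans (le_normcB _ _) _.
  have : Q * s ^+ 2 <= s * (e / 2).
    rewrite expr2 mulrCA ler_pM2l //; apply: le_trans sQ.
    rewrite mulrC ler_pM2l //; have := ler_norm Q; lra.
  move: Ht Bt => /=; lra.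
have lim w : normc w <= r / 2 ->
    normc (F (shift_coord z j w) - F z - w * d) <= Q * normc w ^+ 2.
  move=> ws; apply: (cvg_normc_le FF (cvgB_pt (cvgB_pt (cv w ws) cv0) (@cvgMl_pt w _ _ Hd))).
  by move=> t; have [_] := bound t; apply.
have -> : partial j F z = d by exact: partial_eq lim.
by split=> // t; have [] := bound t.
Qed.

Lemma poly_limit_partial F z0 r P j : poly_limit F z0 r P ->
  poly_limit (partial j F) z0 (r / 2) (fun t => partial j (P t)).
Proof.
move=> V; have [r0 pP _] := V; split; first by rewrite divr_gt0.
  by move=> t; exact: polyfun_partial.
have [K [B HB]] := poly_limit_taylor1 j V.
by exists B => z /HB[].
Qed.

Lemma poly_limit_mpartial F z0 r P K : poly_limit F z0 r P ->
  exists r', poly_limit (mpartial K F) z0 r' (fun t => mpartial K (P t)).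
Proof.
rewrite /mpartial => V; elim: (enum _) => /= [|i s [r' IH]]; first by exists r.
elim: (K i) => /= [|k [r'' IHk]]; first by exists r'.
by exists (r'' / 2); exact: poly_limit_partial.
Qed.

Lemma poly_limit_center F z0 r P : poly_limit F z0 r P -> P t z0 @[t --> Phi] --> F z0.
Proof.
move=> [r0 _ [B HB]]; have [] // := HB z0.
by apply: polydisc_center => j; rewrite mxE ltW.
Qed.

(** Partial derivatives of F commute because those of polynomials do and both sides
    are limits of derivatives of the P t. *)
Lemma partial_mpartial_poly_limit F z0 r P j K : poly_limit F z0 r P ->
  partial j (mpartial K F) z0 = mpartial (incr_midx K j) F z0.
Proof.
move=> V; have [_ pP _] := V.
have [r1 /(poly_limit_partial j)/poly_limit_center c1] := poly_limit_mpartial K V.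
have [r2 /poly_limit_center c2] := poly_limit_mpartial (incr_midx K j) V.
have E : (fun t => partial j (mpartial K (P t)) z0) =
    (fun t => mpartial (incr_midx K j) (P t) z0).
  by apply/funext => t; rewrite partial_mpartial_polyfun.
rewrite E in c1; rewrite -(cvg_lim (@norm_hausdorff _ _) c1).
apply: cvg_lim c2; exact: norm_hausdorff.
Qed.

Lemma poly_limit_taylor2 F z0 r P j : poly_limit F z0 r P -> exists a b : C, exists K s : R,
  0 < s /\ forall w, normc w <= s ->
    normc (F (shift_coord z0 j w) - (F z0 + w * a + w ^+ 2 / 2 * b)) <= K * normc w ^+ 3.
Proof.
move=> V; have [r0 pP [B HB]] := V.
have V1 := poly_limit_partial j V; have c2 := poly_limit_center (poly_limit_partial j V1).
exists (partial j F z0), (partial j (partial j F) z0), (8 * B / r ^+ 3), r.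
split=> // w wr.
have inr u : normc u <= r -> polydisc z0 (const_mx r) (shift_coord z0 j u).
  rewrite -[in const_mx r](add0r r); apply: polydisc_shift_coord.
  by apply: polydisc_center => i; rewrite mxE.
have [_ cw] := HB _ (inr _ wr).
apply: (cvg_normc_le FF (cvgB_pt cw (cvgD_pt (cvgD_pt (poly_limit_center V)
  (@cvgMl_pt w _ _ (poly_limit_center V1))) (@cvgMl_pt (w ^+ 2 / 2) _ _ c2)))).
move=> t; have [e Pe] := pP t; have [p Hp] := pexp_slice j e z0.
have [|_ _ /(_ w wr)] := @poly_taylor_bounds _ p r B r0.
  by move=> u ur; have [<- _ _] := Hp u; rewrite -Pe; have [+ _] := HB _ (inr _ ur); apply.
rewrite Pe !partial_peval; have [-> _ _] := Hp w.
by have := Hp 0; rewrite shift_coord0 => -[-> -> ->].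
Qed.

End LocalPolynomialLimits.

(** * Power series as limits of bounded polynomials *)

Section PowerSeries.
Context {R : realType}.
Local Notation C := R[i].

Lemma normc_sum (I : Type) (s : seq I) (P : pred I) (a : I -> C) :
  normc (\sum_(i <- s | P i) a i) <= \sum_(i <- s | P i) normc (a i).
Proof.
elim/big_rec2: _ => [|i x y _ IH]; first by rewrite normc0.
by apply: le_trans (le_normcD _ _) _; rewrite lerD2l.
Qed.

Lemma normc_prod (I : Type) (s : seq I) (P : pred I) (a : I -> C) :
  normc (\prod_(i <- s | P i) a i) = \prod_(i <- s | P i) normc (a i).
Proof. by apply: (big_morph _ (@normcM _)); exact: normc1. Qed.

Lemma partial_sumE (I : choiceType) (V : zmodType) (a : I -> V) (S : {fset I}) :
  summability.partial_sum a S = \sum_(i <- S) a i.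
Proof. by rewrite big_seq_fsetE. Qed.

(** If S0 is a finite set beyond which the net stays within 1 of its limit, the sum
    over s is the sum over the union of s and S0 minus a part of the sum over S0. *)
Lemma totally_cvg_bounded_sums (I : choiceType) (a : I -> C) (l : C) :
  summability.partial_sum a @ summability.totally --> l ->
  exists B : R, forall s : seq I, uniq s -> normc (\sum_(i <- s) a i) <= B.
Proof.
move=> /cvg_normcP/(_ 1 ltr01)[S0 _ HS].
exists (normc l + 1 + \sum_(i <- S0) normc (a i)) => s us.
pose U := s ++ [seq i <- S0 | i \notin s].
have uU : uniq U.
  rewrite cat_uniq us filter_uniq ?fset_uniq // andbT /=.
  by apply/hasPn => i; rewrite mem_filter => /andP[].
pose S : {fset I} := [fset i in U]%fset.
have SU : perm_eq S U.
  by apply: uniq_perm uU _ => [|i]; [exact: fset_uniq|rewrite in_fset].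
have S0S : (S0 `<=` S)%fset.
  apply/fsubsetP => i iS.
  rewrite in_fset.
  rewrite mem_cat mem_filter iS.
  by case: (i \in s).
have : normc (summability.partial_sum a S - l) <= 1 by exact: HS S0S.
rewrite partial_sumE (perm_big _ SU) /= big_cat big_filter /=.
set x := \sum_(i <- s) _; set y := \sum_(i <- S0 | _) _ => H.
have yB : normc y <= \sum_(i <- S0) normc (a i).
  apply: le_trans (normc_sum _ _ _) _; rewrite [leRHS](bigID (fun i => i \notin s)) /= lerDl.
  by apply: sumr_ge0 => i _; exact: normc_ge0.
have -> : x = l + (x + y - l) - y by ring.
apply: le_trans (le_normcB _ _) _; apply: lerD yB.
by apply: le_trans (le_normcD _ _) _; rewrite lerD2l.
Qed.

(** Splitting a finite index set by the signs of the real parts, then by those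
    of the imaginary parts, turns bounds on all finite sums into absolute ones. *)
Lemma bounded_sums_abs (I : choiceType) (a : I -> C) (B : R) :
  (forall s : seq I, uniq s -> normc (\sum_(i <- s) a i) <= B) ->
  forall s : seq I, uniq s -> \sum_(i <- s) normc (a i) <= 4 * B.
Proof.
move=> aB s us.
have real_part (g : {additive C -> R}) : (forall x, `|g x| <= normc x) ->
    \sum_(i <- s) `|g (a i)| <= 2 * B.
  move=> glip; rewrite (bigID (fun i => 0 <= g (a i))) /=.
  have gB (P : pred I) : `|\sum_(i <- s | P i) g (a i)| <= B.
    rewrite -raddf_sum; apply: le_trans (glip _) _.
    by rewrite -big_filter; apply: aB; exact: filter_uniq.
  rewrite (eq_bigr (fun i => g (a i))); last by move=> i /ger0_norm.
  rewrite [X in _ + X](eq_bigr (fun i => - g (a i))); last first.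
    by move=> i; rewrite -ltNge => /ltr0_norm.
  rewrite sumrN mulr_natl mulr2n; apply: lerD.
    exact: le_trans (ler_norm _) (gB _).
  by apply: le_trans (ler_norm _) _; rewrite normrN gB.
have := real_part (@complex.Re R) (@normr_Re_le R).
have := real_part (@complex.Im R) (@normr_Im_le R).
have : \sum_(i <- s) normc (a i) <= \sum_(i <- s) (`|Re (a i)| + `|Im (a i)|).
  by apply: ler_sum => i _; exact: normc_le_ReIm.
rewrite big_split /=; lra.
Qed.

Context {n : nat}.
Implicit Types (z : 'rV[C]_n) (F : 'rV[C]_n -> C).

Lemma polyfun_sum (I : Type) (s : seq I) (G : I -> 'rV[C]_n -> C) :
  (forall i, polyfun (G i)) -> polyfun (fun z => \sum_(i <- s) G i z).
Proof.
move=> pG; elim: s => [|i s [e He]].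
  by exists (Cst 0); apply/funext => z; rewrite big_nil.
have [d Hd] := pG i; exists (Add d e).
by apply/funext => z; rewrite big_cons /= -He -Hd.
Qed.

Lemma polyfun_prod (I : Type) (s : seq I) (G : I -> 'rV[C]_n -> C) :
  (forall i, polyfun (G i)) -> polyfun (fun z => \prod_(i <- s) G i z).
Proof.
move=> pG; elim: s => [|i s [e He]].
  by exists (Cst 1); apply/funext => z; rewrite big_nil.
have [d Hd] := pG i; exists (Mul d e).
by apply/funext => z; rewrite big_cons /= -He -Hd.
Qed.

Lemma polyfun_monomial (c : C) z0 (K : midx n) :
  polyfun (fun z => c * mpow (z - z0) K).
Proof.
have [e He] : polyfun (fun z => mpow (z - z0) K).
  rewrite /mpow; apply: polyfun_prod => j.
  elim: (K j) => [|k [e He]].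
    by exists (Cst 1); apply/funext => z; rewrite expr0.
  exists (Mul (Add (Var j) (Cst (- z0 0 j))) e).
  by apply/funext => z; rewrite exprS /= -He !mxE.
by exists (Mul (Cst c) e); apply/funext => z; rewrite /= -He.
Qed.

Definition power_sums (c : midx n -> C) z0 (S : {fset midx n}) z : C :=
  summability.partial_sum (fun K => c K * mpow (z - z0) K) S.

(** Unconditional convergence at the single point z0 + (r, ..., r) bounds the sums of
    |c_K| r^||K||, hence all partial sums on the closed polydisc of radius r. *)
Lemma analytic_poly_limit F z0 : analytic_on_ball F -> unit_ball z0 ->
  exists r c, poly_limit (Phi := summability.totally) F z0 r (power_sums c z0).
Proof.
move=> Fan /Fan[c /nbhs_ballP[[e e'] /=]].
rewrite ltcE /= => /andP[/eqP-> e0] near_cvg.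
pose r := e / 2.
have r0 : 0 < r by rewrite divr_gt0.
have cvgP z : polydisc z0 (const_mx r) z ->
    power_sums c z0 S z @[S --> summability.totally] --> F z.
  move=> zr; apply: near_cvg; split=> [|i j]; first by rewrite ltcE /= eqxx.
  rewrite ord1.
  rewrite /ball /= normCE ltcR normc_sub; apply: le_lt_trans (zr j) _.
  by rewrite mxE ltr_pdivrMr // ltr_pMr // ltr1n.
exists r, c; split=> //.
  move=> S; have -> : power_sums c z0 S = fun z => \sum_(K <- S) c K * mpow (z - z0) K.
    by apply/funext => z; exact: partial_sumE.
  by apply: polyfun_sum => K; exact: polyfun_monomial.
pose z1 := z0 + const_mx r%:C.
have z1r : polydisc z0 (const_mx r) z1.
  by move=> j; rewrite !mxE (addrC (z0 0 j)) addrK normc_real gtr0_norm.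
have [B HB] := totally_cvg_bounded_sums (cvgP _ z1r).
exists (4 * B) => z zr; split; last exact: cvgP.
move=> S; rewrite /power_sums partial_sumE.
apply: le_trans (normc_sum _ _ _) _.
apply: le_trans (bounded_sums_abs HB (fset_uniq S)).
apply: ler_sum => K _; rewrite !normcM ler_wpM2l ?normc_ge0 //.
rewrite /mpow !normc_prod; apply: ler_prod => j _; rewrite normc_ge0 /= !normcX.
apply: lerXn2r; rewrite ?nnegrE ?normc_ge0 //.
by have := zr j; rewrite !mxE (addrC (z0 0 j)) addrK normc_real gtr0_norm.
Qed.

End PowerSeries.

(** * Gronwall and Landau inequalities in a real variable *)

Section RealVariable.
Context {R : realType}.
Local Notation C := R[i].

Lemma is_derive_quadratic (f : R -> R) (t d K s : R) : 0 < s ->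
  (forall h, `|h| <= s -> `|f (t + h) - f t - h * d| <= K * h ^+ 2) ->
  is_derive t 1 f d.
Proof.
move=> s0 H.
suff cv : h^-1 *: (f (h *: 1 + t) - f t) @[h --> 0^'] --> d.
  apply: DeriveDef; first by apply/cvg_ex; exists d.
  by apply: cvg_lim cv; exact: norm_hausdorff.
apply/cvgrPdist_le => e e0.
have K1 : 0 < `|K| + 1 by rewrite ltr_pwDr.
have d0 : 0 < Num.min s (e / (`|K| + 1)) by rewrite lt_min s0 divr_gt0.
near=> h.
have h0 : h != 0 by near: h; exact: nbhs_dnbhs_neq.
have : `|h| < Num.min s (e / (`|K| + 1)) by near: h; exact: dnbhs0_lt.
rewrite lt_min => /andP[hs]; rewrite ltr_pdivlMr // => he.
rewrite distrC scaler1 (addrC h t).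
have -> : h^-1 *: (f (t + h) - f t) - d = h^-1 * (f (t + h) - f t - h * d).
  by rewrite /GRing.scale /=; field.
rewrite normrM normfV mulrC ler_pdivrMr ?normr_gt0 //.
apply: le_trans (H _ (ltW hs)) _.
rewrite -real_normK ?num_real // expr2 mulrA ler_pM2r ?normr_gt0 //.
apply: le_trans (ltW he); rewrite mulrC ler_pM2l ?normr_gt0 //.
by rewrite (le_trans (ler_norm K)) // lerDl.
Unshelve. all: by end_near.
Qed.

(** A quadratic remainder, as produced by the Taylor estimates above, is easier to
    transport along segments than a limit of difference quotients. *)
Definition cderive (f : R -> C) (t : R) (d : C) : Prop :=
  exists K s : R, 0 < s /\ forall h : R, `|h| <= s ->
    normc (f (t + h) - f t - h%:C * d) <= K * h ^+ 2.

Lemma cderive_Re f t d : cderive f t d -> is_derive t 1 (fun u => Re (f u)) (Re d).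
Proof.
move=> [K [s [s0 H]]]; apply: (is_derive_quadratic (K := K) s0) => h /H.
apply: le_trans; have := normr_Re_le (f (t + h) - f t - h%:C * d).
by rewrite !raddfB /=; case: d {H} => a b /=; rewrite mul0r subr0.
Qed.

Lemma cderive_Im f t d : cderive f t d -> is_derive t 1 (fun u => Im (f u)) (Im d).
Proof.
move=> [K [s [s0 H]]]; apply: (is_derive_quadratic (K := K) s0) => h /H.
apply: le_trans; have := normr_Im_le (f (t + h) - f t - h%:C * d).
by rewrite !raddfB /=; case: d {H} => a b /=; rewrite mul0r addr0.
Qed.

Lemma is_derive_mul (u v : R -> R) (t a b : R) :
  is_derive t 1 u a -> is_derive t 1 v b ->
  is_derive t 1 (fun x => u x * v x) (u t * b + v t * a).
Proof. by move=> ua vb; exact: is_deriveM ua vb. Qed.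

Lemma is_derive_add (u v : R -> R) (t a b : R) :
  is_derive t 1 u a -> is_derive t 1 v b ->
  is_derive t 1 (fun x => u x + v x) (a + b).
Proof. by move=> ua vb; exact: is_deriveD ua vb. Qed.

Lemma is_derive_sum_sqr_normc (I : Type) (s : seq I) (P : pred I)
    (f : I -> R -> C) (d : I -> C) (t : R) :
  (forall i, P i -> cderive (f i) t (d i)) ->
  is_derive t 1 (fun u => \sum_(i <- s | P i) normc (f i u) ^+ 2)
    (\sum_(i <- s | P i) 2 * (Re (f i t) * Re (d i) + Im (f i t) * Im (d i))).
Proof.
move=> H; elim: s => [|i s IH].
  rewrite big_nil (_ : (fun _ => _) = cst 0); first exact: is_derive_cst.
  by apply/funext => u; rewrite big_nil.
rewrite big_cons; case: ifP => Pi; last first.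
  rewrite (_ : (fun u => _) = (fun u => \sum_(i <- s | P i) normc (f i u) ^+ 2)) //.
  by apply/funext => u; rewrite big_cons Pi.
have hR := cderive_Re (H i Pi); have hI := cderive_Im (H i Pi).
have := is_derive_add (is_derive_add (is_derive_mul hR hR) (is_derive_mul hI hI)) IH.
rewrite (_ : (fun u => _) = (fun u => \sum_(i <- i :: s | P i) normc (f i u) ^+ 2)); last first.
  by apply/funext => u; rewrite big_cons Pi sqr_normc_ReIm !expr2.
have -> : Re (f i t) * Re (d i) + Re (f i t) * Re (d i) +
    (Im (f i t) * Im (d i) + Im (f i t) * Im (d i)) =
    2 * (Re (f i t) * Re (d i) + Im (f i t) * Im (d i)) by ring.
by [].
Qed.

(** With S the sum of the |f_i|^2, the estimate 2 Re (f_i conj(d_i)) <= |f_i|^2 + |d_i|^2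
    gives S' <= (1 + c) S, so S(t) exp(-(1 + c) t) does not increase. *)
Lemma gronwall (I : Type) (s : seq I) (P : pred I) (f d : I -> R -> C) (c : R) :
  (forall i t, P i -> 0 <= t <= 1 -> cderive (f i) t (d i t)) ->
  (forall t, 0 <= t <= 1 -> \sum_(i <- s | P i) normc (d i t) ^+ 2 <=
     c * \sum_(i <- s | P i) normc (f i t) ^+ 2) ->
  \sum_(i <- s | P i) normc (f i 1) ^+ 2 <=
    expR (1 + c) * \sum_(i <- s | P i) normc (f i 0) ^+ 2.
Proof.
move=> fd dc.
pose S (t : R) := \sum_(i <- s | P i) normc (f i t) ^+ 2.
pose S' (t : R) := \sum_(i <- s | P i) 2 * (Re (f i t) * Re (d i t) + Im (f i t) * Im (d i t)).
have dS (t : R) : 0 <= t <= 1 -> is_derive t 1 S (S' t).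
  by move=> t01; apply: is_derive_sum_sqr_normc => i Pi; exact: fd.
have S'le (t : R) : 0 <= t <= 1 -> S' t <= (1 + c) * S t.
  move=> t01; rewrite mulrDl mul1r; apply: le_trans (lerD (lexx (S t)) (dc t t01)).
  rewrite /S /S' -big_split /=; apply: ler_sum => i _.
  rewrite !sqr_normc_ReIm.
  move: (Re _) (Im _) (Re _) (Im _) => a b a' b'.
  have := sqr_ge0 (a - a'); have := sqr_ge0 (b - b'); nra.
pose E (t : R) := expR (- (1 + c) * t).
have dE (t : R) : is_derive t 1 E (- (1 + c) * E t).
  rewrite /E; apply: is_derive_eq; rewrite /GRing.scale /=; ring.
have dSE (t : R) : 0 <= t <= 1 -> is_derive t 1 (S * E) (S t * (- (1 + c) * E t) + E t * S' t).
  by move=> /dS h; apply: is_derive_eq.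
have [||t] := @MVT_segment R (S * E) (fun t => S t * (- (1 + c) * E t) + E t * S' t) 0 1 ler01 _ _.
- by move=> x; rewrite in_itv /= => /andP[/ltW x0 /ltW x1]; apply: dSE; rewrite x0.
- by apply: derivable_within_continuous => x; rewrite in_itv /= => /dSE[].
rewrite in_itv /= => t01.
rewrite subr0 mulr1 /= -[(S * E) 1]/(S 1 * E 1) -[(S * E) 0]/(S 0 * E 0).
rewrite {2}/E mulr0 expR0 mulr1 => eq.
have E0 : 0 < E t by exact: expR_gt0.
have neg : S t * (- (1 + c) * E t) + E t * S' t <= 0.
  have -> : S t * (- (1 + c) * E t) + E t * S' t = E t * (S' t - (1 + c) * S t) by ring.
  by rewrite pmulr_rle0 // subr_le0 S'le.
have : S 1 * E 1 <= S 0 by lra.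
rewrite /E mulr1 expRN -/(S 1) -/(S 0) ler_pdivrMr ?expR_gt0 // mulrC //.
Qed.

(** By the mean value theorem f1 is at most 2M/s somewhere on [0, s], and it varies by
    at most sB on that interval. *)
Lemma real_landau (f f1 f2 : R -> R) (s M B : R) : 0 < s ->
  (forall t, 0 <= t <= s -> is_derive t 1 f (f1 t)) ->
  (forall t, 0 <= t <= s -> is_derive t 1 f1 (f2 t)) ->
  (forall t, 0 <= t <= s -> `|f t| <= M) ->
  (forall t, 0 <= t <= s -> `|f2 t| <= B) ->
  `|f1 0| <= 2 * M / s + s * B.
Proof.
move=> s0 d1 d2 fM fB.
have [||x] := @MVT_segment R f f1 0 s (ltW s0) _ _.
- by move=> x; rewrite in_itv /= => /andP[/ltW x0 /ltW x1]; apply: d1; rewrite x0.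
- by apply: derivable_within_continuous => x; rewrite in_itv /= => /d1[].
rewrite in_itv /= subr0 => /andP[x0 xs] e1.
have ys (y : R) : 0 <= y <= x -> 0 <= y <= s.
  by move=> /andP[-> yx]; exact: le_trans yx xs.
have [||y] := @MVT_segment R f1 f2 0 x x0 _ _.
- by move=> y; rewrite in_itv /= => /andP[/ltW y0 /ltW yx]; apply/d2/ys; rewrite y0.
- by apply: derivable_within_continuous => y; rewrite in_itv /= => /ys/d2[].
rewrite in_itv /= subr0 => /ys y0s e2.
have f1x : `|f1 x| <= 2 * M / s.
  rewrite ler_pdivlMr // -[X in _ * X](gtr0_norm s0) -normrM -e1.
  apply: le_trans (ler_normB _ _) _.
  have := fM 0; have := fM s; rewrite !lexx (ltW s0) /= => /(_ isT) h1 /(_ isT) h2; lra.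
have : `|f2 y * x| <= s * B.
  rewrite normrM mulrC (ger0_norm x0) ler_pM //.
  exact: fB.
have -> : f1 0 = f1 x - f2 y * x by rewrite -e2; ring.
have := ler_normB (f1 x) (f2 y * x); lra.
Qed.

(** For small s the second derivative B enters with an arbitrarily small weight, at
    the price of a large weight 4/s on M. The outer factor 2 comes from treating real
    and imaginary parts separately. *)
Lemma complex_landau (f f1 f2 : R -> C) (s M B : R) : 0 < s ->
  (forall t, 0 <= t <= s -> cderive f t (f1 t)) ->
  (forall t, 0 <= t <= s -> cderive f1 t (f2 t)) ->
  (forall t, 0 <= t <= s -> normc (f t) <= M) ->
  (forall t, 0 <= t <= s -> normc (f2 t) <= B) ->
  normc (f1 0) <= 2 * (2 * M / s + s * B).
Proof.
move=> s0 d1 d2 fM fB.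
have hR : `|Re (f1 0)| <= 2 * M / s + s * B.
  apply: (@real_landau (fun t => Re (f t)) (fun t => Re (f1 t)) (fun t => Re (f2 t))) => // t ts.
  - exact/cderive_Re/d1.
  - exact/cderive_Re/d2.
  - exact: le_trans (normr_Re_le _) (fM _ ts).
  - exact: le_trans (normr_Re_le _) (fB _ ts).
have hI : `|Im (f1 0)| <= 2 * M / s + s * B.
  apply: (@real_landau (fun t => Im (f t)) (fun t => Im (f1 t)) (fun t => Im (f2 t))) => // t ts.
  - exact/cderive_Im/d1.
  - exact/cderive_Im/d2.
  - exact: le_trans (normr_Im_le _) (fM _ ts).
  - exact: le_trans (normr_Im_le _) (fB _ ts).
by apply: le_trans (normc_le_ReIm _) _; lra.
Qed.

End RealVariable.

(** * Polydiscs in the ball, multi-indices, and comparison of weights *)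

Section BallGeometry.
Context {R : realType} {n : nat}.
Local Notation C := R[i].
Implicit Types (z : 'rV[C]_n) (r : 'rV[R]_n) (K : midx n).

Lemma sqr_vnorm r : vnorm r ^+ 2 = \sum_(j < n) r 0 j ^+ 2.
Proof. by rewrite sqr_sqrtr // sumr_ge0 // => j _; exact: sqr_ge0. Qed.

Lemma sqr_cvnorm z : cvnorm z ^+ 2 = \sum_(j < n) normc (z 0 j) ^+ 2.
Proof. by rewrite sqr_sqrtr // sumr_ge0 // => j _; exact: sqr_ge0. Qed.

Lemma coord_le_vnorm r j : r 0 j <= vnorm r.
Proof.
apply: le_trans (ler_norm _) _; rewrite -sqrtr_sqr ler_wsqrtr //.
by rewrite (bigD1 j) //= lerDl sumr_ge0 // => i _; exact: sqr_ge0.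
Qed.

(** Convexity of the square gives (x + y)^2 <= x^2 / s + y^2 / (1 - s) for 0 < s < 1.
    Summing, with s strictly between A and 1 - B where B is the norm of b, bounds the
    left-hand side by A + B < 1. *)
Lemma sum_sqr_lt1 (a b : 'I_n -> R) (A : R) : 0 <= A ->
  \sum_j a j ^+ 2 = A ^+ 2 -> \sum_j b j ^+ 2 < (1 - A) ^+ 2 -> A < 1 ->
  \sum_j (a j + b j) ^+ 2 < 1.
Proof.
move=> A0 aA bA A1.
pose B := Num.sqrt (\sum_j b j ^+ 2).
have B0 : 0 <= B by exact: sqrtr_ge0.
have BE : \sum_j b j ^+ 2 = B ^+ 2.
  by rewrite sqr_sqrtr // sumr_ge0 // => j _; exact: sqr_ge0.
have B1 : B < 1 - A.
  by rewrite -(ltr_pXn2r (ltn0Sn 1)) ?nnegrE ?subr_ge0 ?(ltW A1) // -BE.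
pose s := (A + (1 - B)) / 2.
have s0 : 0 < s by rewrite /s; lra.
have s1 : 0 < 1 - s by rewrite /s; lra.
have As : A <= s by rewrite /s; lra.
have Bs : B <= 1 - s by rewrite /s; lra.
have le : \sum_j (a j + b j) ^+ 2 <= \sum_j (a j ^+ 2 / s + b j ^+ 2 / (1 - s)).
  apply: ler_sum => j _; move: (a j) (b j) => x y.
  rewrite -subr_ge0 (_ : _ - _ = ((1 - s) * x - s * y) ^+ 2 / (s * (1 - s))).
    by rewrite divr_ge0 ?sqr_ge0 // mulr_ge0 // ltW.
  by field; rewrite !gt_eqF.
apply: le_lt_trans le _; rewrite big_split /= -!mulr_suml aA BE.
have : A ^+ 2 / s <= A by rewrite ler_pdivrMr // expr2 ler_wpM2l.
have : B ^+ 2 / (1 - s) <= B by rewrite ler_pdivrMr // expr2 ler_wpM2l.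
lra.
Qed.

Lemma polydisc_sub_ball (beta : R) (l : 'rV[R]_n) z0 r :
  unit_ball z0 -> (forall j, beta / (1 - cvnorm z0) < l 0 j) ->
  nonneg_vec r -> vnorm r < beta ->
  polydisc z0 (vdiv r l) `<=` unit_ball.
Proof.
move=> z0B lbeta r0 rb z zr.
have beta0 : 0 < beta by apply: le_lt_trans rb; exact: sqrtr_ge0.
have A0 : 0 <= cvnorm z0 by exact: sqrtr_ge0.
have A1 : 0 < 1 - cvnorm z0 by rewrite subr_gt0.
have l0 j : 0 < l 0 j by apply: lt_trans (lbeta j); rewrite divr_gt0.
rewrite /unit_ball /= /cvnorm -sqrtr1 ltr_sqrt //.
apply: (@le_lt_trans _ _ (\sum_j (normc (z0 0 j) + r 0 j / l 0 j) ^+ 2)).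
  apply: ler_sum => j _; apply: lerXn2r;
    rewrite ?nnegrE ?addr_ge0 ?normc_ge0 ?divr_ge0 ?(ltW (l0 j)) //.
  rewrite -[z 0 j](subrK (z0 0 j)) addrC; apply: le_trans (le_normcD _ _) _.
  by rewrite lerD2l; have := zr j; rewrite mxE.
apply: (@sum_sqr_lt1 _ _ (cvnorm z0)) => //; first by rewrite sqr_cvnorm.
have -> : (1 - cvnorm z0) ^+ 2 = ((1 - cvnorm z0) / beta) ^+ 2 * beta ^+ 2.
  by rewrite -exprMn divfK ?gt_eqF.
apply: (@le_lt_trans _ _ (((1 - cvnorm z0) / beta) ^+ 2 * vnorm r ^+ 2)).
  rewrite sqr_vnorm mulr_sumr; apply: ler_sum => j _; rewrite -exprMn.
  have rl0 : 0 <= r 0 j / l 0 j by apply: divr_ge0; [exact: r0|exact: ltW].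
  have Ar0 : 0 <= (1 - cvnorm z0) / beta * r 0 j.
    by apply: mulr_ge0 (r0 j); apply: divr_ge0; exact: ltW.
  apply: lerXn2r; rewrite ?nnegrE // mulrC; apply: ler_wpM2r; first exact: r0.
  by rewrite -[leRHS]invrK lef_pV2 ?posrE ?invr_gt0 ?divr_gt0 // invfM invrK mulrC ltW.
rewrite ltr_pM2l ?exprn_gt0 ?divr_gt0 //.
by rewrite ltr_pXn2r ?nnegrE ?sqrtr_ge0 // ltW.
Qed.

Lemma mpow_gt0 (a : 'rV[R]_n) K : (forall j, 0 < a 0 j) -> 0 < mpow a K.
Proof. by move=> a0; apply: prodr_gt0 => j _; exact: exprn_gt0. Qed.

Lemma mpow_incr (a : 'rV[R]_n) K j : mpow a (incr_midx K j) = mpow a K * a 0 j.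
Proof.
rewrite /mpow; under eq_bigr do rewrite ffunE exprD.
rewrite big_split /=; congr (_ * _).
rewrite (bigD1 j) //= eqxx expr1 big1 ?mulr1 // => i /negbTE ->.
by rewrite expr0.
Qed.

Lemma mpow_scale_le (a b : 'rV[R]_n) (c : R) K : (forall j, 0 <= a 0 j) ->
  (forall j, a 0 j <= c * b 0 j) -> mpow a K <= c ^+ mdeg K * mpow b K.
Proof.
move=> a0 ab; rewrite /mdeg -prodrXr -big_split /=.
apply: ler_prod => j _; rewrite exprn_ge0 //= -exprMn.
by apply: lerXn2r; rewrite ?nnegrE // (le_trans (a0 j)).
Qed.

Lemma mdeg_incr K j : mdeg (incr_midx K j) = (mdeg K).+1.
Proof.
rewrite /mdeg; under eq_bigr do rewrite ffunE.
rewrite big_split /= -addn1; congr (_ + _)%N.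
by rewrite (bigD1 j) //= eqxx big1 // => i /negbTE ->.
Qed.

Lemma midx_incr_ex K : (0 < mdeg K)%N -> exists K' j, K = incr_midx K' j.
Proof.
move=> K0; have [j Kj] : exists j, (0 < K j)%N.
  apply/existsP; apply: contraLR K0 => /existsPn H; rewrite -leqNgt /mdeg big1 // => j _.
  by apply/eqP; have := H j; rewrite lt0n negbK.
exists [ffun i => (K i - (i == j))%N], j; apply/ffunP => i; rewrite !ffunE subnK //.
by case: eqP => [->|].
Qed.

Lemma mfact_gt0 K : (0 < mfact K)%N.
Proof. by apply: prodn_gt0 => j; exact: fact_gt0. Qed.

Lemma mfact_le K d : (mdeg K <= d)%N -> (mfact K <= d`! ^ n)%N.
Proof.
move=> Kd; rewrite /mfact -[X in (_ ^ X)%N]card_ord -prod_nat_const.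
apply: leq_prod => j _; apply: leq_fact; apply: leq_trans Kd.
by rewrite /mdeg (bigD1 j) //= leq_addr.
Qed.

(** One plus the sum of the constants serves all coordinates at once. *)
Lemma fin_uniform_bound (P : 'I_n -> R -> Prop) :
  (forall j c c', c <= c' -> P j c -> P j c') -> (forall j, exists c, P j c) ->
  exists2 c, 1 <= c & forall j, P j c.
Proof.
move=> mono /choice[c Pc]; exists (1 + \sum_j `|c j|).
  by rewrite lerDl sumr_ge0.
move=> j; apply: mono (Pc j); apply: le_trans (ler_norm _) _.
rewrite (bigD1 j) //= addrCA lerDl addr_ge0 // sumr_ge0 //.
Qed.

(** The form in which the class Q is used: one constant, uniform in the centre and in
    the coordinate, bounds the ratios of weights from both sides. *)
Lemma classQ_ratio (beta : R) (L : 'rV[C]_n -> 'rV[R]_n) r :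
  classQ beta L -> (forall z, unit_ball z -> forall j, 0 < L z 0 j) ->
  nonneg_vec r -> vnorm r < beta ->
  exists2 c : R, 1 <= c & forall z0 z, unit_ball z0 -> polydisc z0 (vdiv r (L z0)) z ->
    forall j, L z 0 j <= c * L z0 0 j /\ L z0 0 j <= c * L z 0 j.
Proof.
move=> [adm LQ] L0 r0 rb.
suff [c c1 Hc] : exists2 c, 1 <= c & forall j z0 z, unit_ball z0 ->
    polydisc z0 (vdiv r (L z0)) z -> L z 0 j <= c * L z0 0 j /\ L z0 0 j <= c * L z 0 j.
  by exists c => // z0 z z0B zr j; exact: Hc.
apply: (@fin_uniform_bound (fun j c => forall z0 z, unit_ball z0 ->
    polydisc z0 (vdiv r (L z0)) z -> L z 0 j <= c * L z0 0 j /\ L z0 0 j <= c * L z 0 j)).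
- move=> j c c' cc' H z0 z z0B zr; have [h1 h2] := H z0 z z0B zr.
  have zB : unit_ball z.
    by apply: (polydisc_sub_ball z0B _ r0 rb zr) => i; have [_ +] := adm i; apply.
  by split; [apply: le_trans h1 _|apply: le_trans h2 _];
    rewrite ler_wpM2r // ltW // L0.
move=> j; have [] := LQ r r0 (ltW rb) j; rewrite /lambda1 /lambda2.
set Q := lratios L j r => l1 _ l2.
have [a [a0 Ha]] : exists a : R, 0 < a /\ forall q, Q q -> (a%:E <= q)%E.
  case E : (ereal_inf Q) l1 => [a| |] // a0.
    by exists a; split=> // q Qq; rewrite -E; exact: ereal_inf_lbound.
  by exists 1; split=> // q /ereal_inf_lbound; rewrite E leye_eq => /eqP->; rewrite leey.
have [b Hb] : exists b : R, forall q, Q q -> (q <= b%:E)%E.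
  case E : (ereal_sup Q) l2 => [b| |] // _.
    by exists b => q Qq; rewrite -E; exact: ereal_sup_ubound.
  by exists 0 => q /ereal_sup_ubound; rewrite E leeNy_eq => /eqP->; rewrite leNye.
exists (Num.max b a^-1) => z0 z z0B zr.
have q : Q (L z 0 j / L z0 0 j)%:E by exists z0, z.
have := Ha _ q; have := Hb _ q; rewrite !lee_fin.
have l0 := L0 _ z0B j; rewrite ler_pdivrMr // ler_pdivlMr // => hb ha.
have zB : unit_ball z.
  by apply: (polydisc_sub_ball z0B _ r0 rb zr) => i; have [_ +] := adm i; apply.
split; first by apply: le_trans hb _; rewrite ler_pM2r // le_max lexx.
apply: (@le_trans _ _ (a^-1 * L z 0 j)); first by rewrite mulrC ler_pdivlMr // mulrC.
by rewrite ler_pM2r ?L0 // le_max lexx orbT.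
Qed.

End BallGeometry.

(** * Derivatives normalized by the weights *)

Section NormalizedDerivatives.
Context {R : realType} {n : nat}.
Local Notation C := R[i].
Implicit Types (z : 'rV[C]_n) (r l : 'rV[R]_n) (K : midx n).
Context {F : 'rV[C]_n -> C} (Fan : analytic_on_ball F).

Lemma analytic_partial K j z : unit_ball z -> exists Q s : R, 0 < s /\
  forall w, normc w <= s -> normc (mpartial K F (shift_coord z j w) - mpartial K F z
     - w * mpartial (incr_midx K j) F z) <= Q * normc w ^+ 2.
Proof.
move=> zB; have [r [c V]] := analytic_poly_limit Fan zB.
have [r' V'] := poly_limit_mpartial K V.
have [r'0 _ _] := V'.
have [Q [B H]] := poly_limit_taylor1 j V'.
exists Q, (r' / 2); split; first by rewrite divr_gt0.
rewrite -(partial_mpartial_poly_limit j K V).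
have zr : polydisc z (const_mx (r' / 2)) z.
  by apply: polydisc_center => i; rewrite mxE divr_ge0 // ltW.
by have [_ _] := H z zr.
Qed.

Lemma analytic_taylor2 z j w : unit_ball (shift_coord z j w) ->
  taylor2 (fun u => F (shift_coord z j u)) w.
Proof.
move=> zB; have [r [c V]] := analytic_poly_limit Fan zB.
have [a [b [Q [s [s0 H]]]]] := poly_limit_taylor2 j V.
exists a, (b / 2), Q, s; split=> // u us.
rewrite -shift_coordD (_ : _ + b / 2 * u ^+ 2 =
  F (shift_coord z j w) + u * a + u ^+ 2 / 2 * b); first exact: H.
by field.
Qed.

Definition nderiv l K z : C := mpartial K F z / (mpow l K)%:C.

Lemma normc_nderiv l K z : (forall j, 0 < l 0 j) ->
  normc (nderiv l K z) = normc (mpartial K F z) / mpow l K.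
Proof.
by move=> l0; rewrite normcM normcV normc_real gtr0_norm ?mpow_gt0.
Qed.

Lemma mdeg0 K : mdeg K = 0%N -> K = [ffun=> 0%N].
Proof.
move=> /eqP; rewrite sum_nat_eq0 => /forallP H; apply/ffunP => j.
by rewrite ffunE; have /eqP := H j.
Qed.

Lemma nderiv0 l K z : mdeg K = 0%N -> nderiv l K z = F z.
Proof.
move=> /mdeg0 ->; rewrite /nderiv /mpow big1; last first.
  by move=> j _; rewrite ffunE expr0.
rewrite /mpartial divr1; congr (_ z).
by elim: (enum _) => [//|i s IH]; rewrite [LHS]/= ffunE IH.
Qed.

(** Steps in the coordinate j are measured in units of 1 / l_j, so that differentiation
    shifts the multi-index without producing a weight. *)
Lemma cderive_nderiv l K j z (a : C) (t : R) : (forall j, 0 < l 0 j) ->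
  unit_ball (shift_coord z j (t%:C * (a / (l 0 j)%:C))) ->
  cderive (fun t => nderiv l K (shift_coord z j (t%:C * (a / (l 0 j)%:C)))) t
    (a * nderiv l (incr_midx K j) (shift_coord z j (t%:C * (a / (l 0 j)%:C)))).
Proof.
move=> l0 zB; set w := a / _ in zB *.
have [Q [s [s0 H]]] := analytic_partial K j zB.
have k0 := mpow_gt0 K l0.
exists (Q * normc w ^+ 2 / mpow l K), (s / (normc w + 1)).
have w1 : 0 < normc w + 1 by rewrite ltr_wpDl ?normc_ge0.
split=> [|h hs]; first by rewrite divr_gt0.
rewrite rmorphD mulrDl -shift_coordD.
have hw : normc (h%:C * w) <= s.
  rewrite normcM normc_real; move: hs; rewrite ler_pdivlMr // => hs.
  by apply: le_trans hs; rewrite ler_wpM2l // lerDl.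
have := H _ hw; move: (shift_coord z j (t%:C * w)) => p.
rewrite /nderiv mpow_incr rmorphM /=.
have -> : mpartial K F (shift_coord p j (h%:C * w)) / (mpow l K)%:C - mpartial K F p / (mpow l K)%:C
    - h%:C * (a * (mpartial (incr_midx K j) F p / ((mpow l K)%:C * (l 0 j)%:C))) =
   (mpartial K F (shift_coord p j (h%:C * w)) - mpartial K F p
     - h%:C * w * mpartial (incr_midx K j) F p) / (mpow l K)%:C.
  rewrite /w; field.
  by rewrite !(inj_eq (@complexI R)) !gt_eqF.
rewrite [in X in _ -> X]normcM normcV normc_real gtr0_norm // => le.
rewrite [leRHS]mulrAC ler_pM2r ?invr_gt0 //; apply: le_trans le _.
rewrite (_ : Q * _ = Q * normc w ^+ 2 * h ^+ 2) //.
by rewrite normcM exprMn normc_real real_normK ?num_real //; ring.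
Qed.

(** A Euclidean norm rather than a maximum, because its square is differentiable along
    segments. *)
Definition nsize m l z : R :=
  Num.sqrt (\sum_(K : {ffun 'I_n -> 'I_m.+1} | (mdeg (midx_of K) <= m)%N)
     normc (nderiv l (midx_of K) z) ^+ 2).

Lemma nsize_ge0 m l z : 0 <= nsize m l z.
Proof. exact: sqrtr_ge0. Qed.

Lemma sqr_nsize m l z : nsize m l z ^+ 2 =
  \sum_(K : {ffun 'I_n -> 'I_m.+1} | (mdeg (midx_of K) <= m)%N)
     normc (nderiv l (midx_of K) z) ^+ 2.
Proof. by rewrite sqr_sqrtr // sumr_ge0 // => K _; exact: sqr_ge0. Qed.

Lemma midx_of_ex m K : (mdeg K <= m)%N -> exists K' : {ffun 'I_n -> 'I_m.+1}, K = midx_of K'.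
Proof.
move=> Km; exists [ffun j => inord (K j)]; apply/ffunP => j.
rewrite !ffunE inordK // ltnS; apply: leq_trans Km.
by rewrite /mdeg (bigD1 j) //= leq_addr.
Qed.

Lemma nderiv_le_nsize m l K z : (mdeg K <= m)%N -> normc (nderiv l K z) <= nsize m l z.
Proof.
move=> /[dup] Km /midx_of_ex[K' E]; rewrite E in Km *.
rewrite -(ler_pXn2r (ltn0Sn 1)) ?nnegrE ?normc_ge0 ?nsize_ge0 // sqr_nsize.
by rewrite (bigD1 K') //= lerDl sumr_ge0 // => i _; exact: sqr_ge0.
Qed.

Lemma nsize_le m l z (x : R) : 0 <= x ->
  (forall K, (mdeg K <= m)%N -> normc (nderiv l K z) <= x) ->
  nsize m l z <= (#|{ffun 'I_n -> 'I_m.+1}|%:R + 1) * x.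
Proof.
move=> x0 H; set N : R := #|_|%:R.
have N0 : 0 <= N by rewrite ler0n.
have N1x : 0 <= (N + 1) * x by rewrite mulr_ge0 // addr_ge0.
rewrite -(ler_pXn2r (ltn0Sn 1)) ?nnegrE ?nsize_ge0 // sqr_nsize.
apply: (@le_trans _ _ (\sum_(K : {ffun 'I_n -> 'I_m.+1}) x ^+ 2)).
  rewrite [leRHS](bigID (fun K : {ffun 'I_n -> 'I_m.+1} => mdeg (midx_of K) <= m)%N) /=.
  apply: ler_wpDr; first by apply: sumr_ge0 => i _; exact: sqr_ge0.
  apply: ler_sum => K Km; apply: lerXn2r; rewrite ?nnegrE ?normc_ge0 //.
  exact: H.
rewrite sumr_const -/N -mulr_natl -/N exprMn ler_wpM2r ?sqr_ge0 //.
nra.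
Qed.

End NormalizedDerivatives.

(** * The maximum principle on polydiscs *)

Section TorusMaximum.
Context {R : realType} {n : nat}.
Local Notation C := R[i].
Implicit Types (z : 'rV[C]_n) (F : 'rV[C]_n -> C) (rho : 'rV[R]_n).

(** The coordinates are released one at a time: once the bound holds on the points
    whose coordinates of index at least k lie on their circles, the principle on a disc
    lets the coordinate k run through its disc. *)
Lemma maximum_modulus_torus F z0 rho (M : R) : analytic_on_ball F ->
  polydisc z0 rho `<=` unit_ball ->
  (forall z, torus z0 rho z -> normc (F z) <= M) ->
  forall z, polydisc z0 rho z -> normc (F z) <= M.
Proof.
move=> Fan rhoB FM.
suff H : forall k, (k <= n)%N -> forall z, polydisc z0 rho z ->
    (forall i : 'I_n, (k <= i)%N -> normc (z 0 i - z0 0 i) = rho 0 i) -> normc (F z) <= M.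
  move=> z zr; apply: (H n (leqnn n) z zr) => i.
  by rewrite leqNgt ltn_ord.
elim=> [_ z zr zT|k IH kn z zr zT]; first by apply: FM => i; exact: zT.
pose j := Ordinal kn; pose p := shift_coord z j (z0 0 j - z 0 j).
have pj w : (shift_coord p j w) 0 j - z0 0 j = w.
  by rewrite !shift_coordE eqxx !mulr1; ring.
have pi w i : i != j -> (shift_coord p j w) 0 i = z 0 i.
  by move=> /negbTE ij; rewrite !shift_coordE ij !mulr0 !addr0.
have pr w : normc w <= rho 0 j -> polydisc z0 rho (shift_coord p j w).
  move=> wr i; have [->|ij] := eqVneq i j; first by rewrite pj.
  by rewrite pi.
have -> : z = shift_coord p j (z 0 j - z0 0 j).
  by rewrite shift_coordD addrC subrKA subrr shift_coord0.
apply: (@maximum_modulus_disc _ (fun w => F (shift_coord p j w)) (rho 0 j) M) => [w wr|w wr|].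
- by apply: (analytic_taylor2 Fan); apply: rhoB; exact: pr.
- apply: IH; [exact: ltnW|by apply: pr; rewrite wr|move=> i ki].
  have [->|ij] := eqVneq i j; first by rewrite pj.
  rewrite pi //; apply: zT; rewrite ltn_neqAle ki andbT.
  by apply: contra_neq ij => ki'; apply: val_inj.
- exact: zr.
Qed.

Lemma torus_nonempty z0 rho : nonneg_vec rho -> exists z, torus z0 rho z.
Proof.
move=> rho0; exists (z0 + \row_j (rho 0 j)%:C) => j.
by rewrite !mxE (addrC (z0 0 j)) addrK normc_real ger0_norm.
Qed.

(** Without the bound B the supremum would be a default value. *)
Lemma le_max_torus F z0 rho (B : R) z : (forall z, torus z0 rho z -> normc (F z) <= B) ->
  torus z0 rho z -> normc (F z) <= max_torus rho z0 F.
Proof.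
move=> FB zT; apply: ub_le_sup; last by exists z.
by exists B => _ [w wT <-]; exact: FB.
Qed.

Lemma max_torus_le F z0 rho (B : R) : nonneg_vec rho ->
  (forall z, torus z0 rho z -> normc (F z) <= B) -> max_torus rho z0 F <= B.
Proof.
move=> rho0 FB; apply: ge_sup; last by move=> _ [w wT <-]; exact: FB.
by have [z zT] := torus_nonempty z0 rho0; exists (normc (F z)), z.
Qed.

Lemma torus_polydisc z0 rho : torus z0 rho `<=` polydisc z0 rho.
Proof. by move=> z zT j; rewrite zT. Qed.

End TorusMaximum.

(** * Functions of bounded index *)

Section BoundedIndex.
Context {R : realType} {n : nat}.
Local Notation C := R[i].
Implicit Types (z : 'rV[C]_n) (r l : 'rV[R]_n) (K : midx n).
Context {beta : R} {L : 'rV[C]_n -> 'rV[R]_n} (beta0 : 0 < beta) (LQ : classQ beta L).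
Context {F : 'rV[C]_n -> C} (Fan : analytic_on_ball F) {m : nat}.
Context (Fidx : forall z, unit_ball z -> forall J : midx n, index_term L F J z <=
   \big[Num.max/0]_(K : {ffun 'I_n -> 'I_m.+1} | (mdeg (midx_of K) <= m)%N)
     index_term L F (midx_of K) z).

Local Notation nderiv := (nderiv (F := F)).
Local Notation nsize := (nsize (F := F) m).

Lemma weight_gt0 z : unit_ball z -> forall j, 0 < L z 0 j.
Proof.
move=> zB j; have [/(_ j)[_ H] _] := LQ; apply: lt_trans (H z zB).
by rewrite divr_gt0 // subr_gt0.
Qed.

Lemma weighted_polydisc_sub_ball r z0 : unit_ball z0 -> nonneg_vec r -> vnorm r < beta ->
  polydisc z0 (vdiv r (L z0)) `<=` unit_ball.
Proof.
move=> z0B r0 rb; apply: polydisc_sub_ball rb => // j.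
by have [/(_ j)[_ H] _] := LQ; exact: H.
Qed.

(** Bounded index compares terms weighted at z, whereas N is weighted at z0; passing
    from one to the other costs powers of c. Order m + 1 is what the differential
    inequality and Landau's inequality need. *)
Lemma nderiv_bound r : nonneg_vec r -> vnorm r < beta -> exists2 A : R, 0 <= A &
  forall z0 z, unit_ball z0 -> polydisc z0 (vdiv r (L z0)) z ->
  forall J, (mdeg J <= m.+1)%N ->
    normc (nderiv (L z0) J z) <= A * nsize (L z0) z.
Proof.
move=> r0 rb; have [c c1 Hc] := classQ_ratio LQ weight_gt0 r0 rb.
have c0 : 0 <= c by apply: le_trans c1; exact: ler01.
exists (c ^+ m * ((m.+1)`! ^ n)%:R * c ^+ m.+1).
  by apply: mulr_ge0; [apply: mulr_ge0; [exact: exprn_ge0|exact: ler0n]|exact: exprn_ge0].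
move=> z0 z z0B zr J Jm.
have zB : unit_ball z by exact: weighted_polydisc_sub_ball zr.
have l0 := weight_gt0 z0B; have lz := weight_gt0 zB.
have mz K : 0 < mpow (L z) K := mpow_gt0 K lz.
have m0 K : 0 < mpow (L z0) K := mpow_gt0 K l0.
have term_le : index_term L F J z <= c ^+ m * nsize (L z0) z.
  apply: le_trans (Fidx zB J) _; apply: bigmax_le => [|K Km].
    by rewrite mulr_ge0 ?exprn_ge0 ?nsize_ge0.
  have := nderiv_le_nsize (F := F) (L z0) z Km; rewrite normc_nderiv //.
  set k := midx_of K in Km * => H.
  apply: (@le_trans _ _ (normc (mpartial k F z) / mpow (L z) k)).
    rewrite /index_term ler_wpM2l ?normc_ge0 // lef_pV2 ?posrE ?mulr_gt0 ?ltr0n ?mfact_gt0 //.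
    by rewrite ler_peMl ?(ltW (mz k)) // ler1n mfact_gt0.
  apply: (@le_trans _ _ (c ^+ mdeg k * (normc (mpartial k F z) / mpow (L z0) k))).
    rewrite mulrCA ler_wpM2l ?normc_ge0 // ler_pdivlMr // mulrC ler_pdivrMr //.
    by apply: mpow_scale_le => j; [exact: ltW|have [] := Hc _ _ z0B zr j].
  apply: ler_pM H; rewrite ?exprn_ge0 ?divr_ge0 ?normc_ge0 ?(ltW (m0 k)) //.
  by rewrite ler_weXn2l.
rewrite normc_nderiv //.
have -> : normc (mpartial J F z) / mpow (L z0) J =
   index_term L F J z * ((mfact J)%:R * (mpow (L z) J / mpow (L z0) J)).
  rewrite /index_term; field.
  by rewrite !gt_eqF ?mz ?m0 ?ltr0n ?mfact_gt0.
have J1 : ((mfact J)%:R : R) <= ((m.+1)`! ^ n)%:R by rewrite ler_nat mfact_le.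
have J2 : mpow (L z) J / mpow (L z0) J <= c ^+ m.+1.
  rewrite ler_pdivrMr //; apply: (@le_trans _ _ (c ^+ mdeg J * mpow (L z0) J)).
    by apply: mpow_scale_le => j; [exact: ltW|have [] := Hc _ _ z0B zr j].
  by rewrite ler_pM2r // ler_weXn2l.
have q0 : 0 <= mpow (L z) J / mpow (L z0) J by rewrite divr_ge0 ?ltW.
have i0 : 0 <= index_term L F J z.
  by rewrite divr_ge0 ?normc_ge0 // mulr_ge0 // ltW.
have fq0 : 0 <= (mfact J)%:R * (mpow (L z) J / mpow (L z0) J) by rewrite mulr_ge0.
apply: le_trans (ler_pM i0 fq0 term_le (ler_pM (ler0n _ _) q0 J1 J2)) _.
move: (c ^+ m.+1) (c ^+ m) (_%:R) (nsize _ _) => a1 a2 a3 a4.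
by rewrite (_ : a2 * a4 * (a3 * a1) = a2 * a3 * a1 * a4) //; ring.
Qed.

(** Along a segment in the direction j the derivative of u_K is a u_(K + e_j) with
    |a| <= r_j; by the hypothesis it is at most beta A N, even for ||K|| = m, so
    Gronwall's inequality applies. *)
Lemma nsize_segment r (A : R) z0 p j (w : C) : nonneg_vec r -> vnorm r < beta ->
  unit_ball z0 -> 0 <= A ->
  (forall z, polydisc z0 (vdiv r (L z0)) z -> forall J, (mdeg J <= m.+1)%N ->
     normc (nderiv (L z0) J z) <= A * nsize (L z0) z) ->
  normc w * L z0 0 j <= r 0 j ->
  (forall t : R, 0 <= t <= 1 -> polydisc z0 (vdiv r (L z0)) (shift_coord p j (t%:C * w))) ->
  nsize (L z0) (shift_coord p j w) ^+ 2 <=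
    expR (1 + #|{ffun 'I_n -> 'I_m.+1}|%:R * (beta * A) ^+ 2) * nsize (L z0) p ^+ 2.
Proof.
move=> r0 rb z0B A0 HA wr seg.
have l0 := weight_gt0 z0B.
pose a := w * (L z0 0 j)%:C.
have wE : w = a / (L z0 0 j)%:C.
  by rewrite /a mulfK // (inj_eq (@complexI R)) gt_eqF.
have na : normc a <= beta.
  rewrite normcM normc_real gtr0_norm //; apply: le_trans wr _.
  by apply: le_trans (coord_le_vnorm r j) (ltW rb).
pose P (K : {ffun 'I_n -> 'I_m.+1}) := (mdeg (midx_of K) <= m)%N.
pose f (K : {ffun 'I_n -> 'I_m.+1}) (t : R) :=
  nderiv (L z0) (midx_of K) (shift_coord p j (t%:C * w)).
pose d (K : {ffun 'I_n -> 'I_m.+1}) (t : R) :=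
  a * nderiv (L z0) (incr_midx (midx_of K) j) (shift_coord p j (t%:C * w)).
have := @gronwall R _ (index_enum _) P f d (#|{ffun 'I_n -> 'I_m.+1}|%:R * (beta * A) ^+ 2).
rewrite /f !mul1r !mul0r shift_coord0 -!sqr_nsize; apply.
  move=> K t _ t01; rewrite /f /d wE; apply: cderive_nderiv => //.
  by rewrite -wE; apply: weighted_polydisc_sub_ball rb _ (seg t t01).
move=> t t01; rewrite -sqr_nsize.
set N := nsize _ _; have N0 : 0 <= N by exact: nsize_ge0.
apply: (@le_trans _ _ (\sum_(K : {ffun 'I_n -> 'I_m.+1}) (beta * A * N) ^+ 2)).
  rewrite [leRHS](bigID P) /=; apply: ler_wpDr.
    by apply: sumr_ge0 => K _; exact: sqr_ge0.
  apply: ler_sum => K Km; apply: lerXn2r; rewrite ?nnegrE ?normc_ge0 ?mulr_ge0 ?(ltW beta0) //.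
  rewrite normcM -mulrA; apply: ler_pM; rewrite ?normc_ge0 //.
  by apply: HA (seg t t01) _ _; rewrite mdeg_incr ltnS.
by rewrite sumr_const -[leLHS]mulr_natl -[leRHS]mulrA -exprMn.
Qed.

Lemma polydisc_segment z0 p j (w : C) (rho : 'rV[R]_n) (t : R) :
  polydisc z0 rho p -> polydisc z0 rho (shift_coord p j w) -> 0 <= t <= 1 ->
  polydisc z0 rho (shift_coord p j (t%:C * w)).
Proof.
move=> pr pwr /andP[t0 t1] i; have := pr i; have := pwr i.
rewrite !shift_coordE; case: eqP => _; last by rewrite !mulr0 !addr0.
rewrite !mulr1 => h1 h2.
have -> : p 0 i + t%:C * w - z0 0 i =
   (1 - t)%:C * (p 0 i - z0 0 i) + t%:C * (p 0 i + w - z0 0 i).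
  by rewrite rmorphB /=; ring.
apply: le_trans (le_normcD _ _) _; rewrite !normcM !normc_real !ger0_norm ?subr_ge0 //.
have : (1 - t) * normc (p 0 i - z0 0 i) <= (1 - t) * rho 0 i by rewrite ler_wpM2l ?subr_ge0.
have : t * normc (p 0 i + w - z0 0 i) <= t * rho 0 i by rewrite ler_wpM2l.
lra.
Qed.

Lemma nsize_polydisc r : nonneg_vec r -> vnorm r < beta -> exists2 E : R, 0 <= E &
  forall z0 z, unit_ball z0 -> polydisc z0 (vdiv r (L z0)) z ->
    nsize (L z0) z <= E * nsize (L z0) z0.
Proof.
move=> r0 rb; have [A A0 HA] := nderiv_bound r0 rb.
pose e : R := expR (1 + #|{ffun 'I_n -> 'I_m.+1}|%:R * (beta * A) ^+ 2).
have e0 : 0 < e by exact: expR_gt0.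
exists (Num.sqrt (e ^+ n)); first exact: sqrtr_ge0.
move=> z0 z z0B zr; have l0 := weight_gt0 z0B.
rewrite -(ler_pXn2r (ltn0Sn 1)) ?nnegrE ?mulr_ge0 ?nsize_ge0 ?sqrtr_ge0 //.
rewrite exprMn (sqr_sqrtr (exprn_ge0 n (ltW e0))).
(* The path from z0 to z replaces the coordinates one after the other. *)
pose h k : 'rV[C]_n := \row_i (if (i < k)%N then z 0 i else z0 0 i).
have hr k : polydisc z0 (vdiv r (L z0)) (h k).
  move=> i; rewrite mxE; case: ifP => _; first exact: zr.
  by rewrite subrr normc0 mxE divr_ge0 ?r0 // ltW.
have hn : h n = z by apply/rowP => i; rewrite mxE ltn_ord.
have h0 : h 0%N = z0 by apply/rowP => i; rewrite mxE.
suff : forall k, (k <= n)%N -> nsize (L z0) (h k) ^+ 2 <= e ^+ k * nsize (L z0) z0 ^+ 2.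
  by move=> /(_ n (leqnn n)); rewrite hn.
elim=> [_|k IH kn]; first by rewrite h0 expr0 mul1r.
rewrite (exprS e) -mulrA; apply: le_trans (ler_wpM2l (ltW e0) (IH (ltnW kn))).
pose j := Ordinal kn.
have hS : h k.+1 = shift_coord (h k) j (z 0 j - z0 0 j).
  apply/rowP => i; rewrite shift_coordE !mxE -val_eqE /= ltnS leq_eqVlt.
  have [ik|_] /= := eqVneq (val i) k; last by rewrite mulr0 addr0.
  have -> : i = j by apply: val_inj; rewrite /= -ik.
  by rewrite /= ltnn mulr1 addrC subrK.
rewrite hS; apply: (nsize_segment r0 rb z0B A0) => [z' z'r J||t t01].
- exact: HA.
- by have := zr j; rewrite mxE ler_pdivlMr.
- by apply: polydisc_segment t01; rewrite -?hS.
Qed.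

(** Induction on the order: a derivative of order k + 1 is the derivative of one of order
    k, so Landau's inequality on a segment of normalized length s bounds it by the bound
    for order k divided by s, plus s A E N(z0). One chooses s small first, then the
    parameter eps' for order k small compared with s. The factor eta leaves room for
    the segment inside the polydisc. *)
Lemma interpolation r : (forall j, 0 < r 0 j) -> vnorm r < beta ->
  forall k, (k <= m)%N -> forall eps eta : R, 0 < eps -> 0 < eta < 1 ->
  exists2 D : R, 0 <= D & forall z0 (M : R), unit_ball z0 ->
    (forall z, polydisc z0 (vdiv r (L z0)) z -> normc (F z) <= M) ->
    forall K z, (mdeg K <= k)%N -> polydisc z0 (eta *: vdiv r (L z0)) z ->
      normc (nderiv (L z0) K z) <= D * M + eps * nsize (L z0) z0.
Proof.
move=> r0 rb.
have rn : nonneg_vec r by move=> j; exact: ltW.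
have [A A0 HA] := nderiv_bound rn rb.
have [E E0 HE] := nsize_polydisc rn rb.
have scaled z0 (eta : R) z : unit_ball z0 -> eta <= 1 ->
    polydisc z0 (eta *: vdiv r (L z0)) z -> polydisc z0 (vdiv r (L z0)) z.
  move=> z0B eta1; apply: polydiscS => j; rewrite !mxE ler_piMl //.
  by rewrite divr_ge0 ?ltW // (weight_gt0).
elim=> [|k IH] km eps eta eps0 /andP[eta0 eta1].
  exists 1; first exact: ler01.
  move=> z0 M z0B FM K z; rewrite leqn0 => /eqP K0 zr.
  rewrite nderiv0 // mul1r; apply: ler_wpDr; first by rewrite mulr_ge0 ?nsize_ge0 ?ltW.
  by apply: FM; apply: scaled zr => //; exact: ltW.
have [d d1 Hd] : exists2 d : R, 1 <= d & forall j, d^-1 <= r 0 j.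
  have [||d d1 Hd] := @fin_uniform_bound R n (fun j d => (r 0 j)^-1 <= d).
  - by move=> j c c' cc' /le_trans; exact.
  - by move=> j; exists (r 0 j)^-1.
  - exists d => // j; rewrite -[leRHS]invrK lef_pV2 ?posrE ?invr_gt0 //.
    exact: lt_le_trans d1.
have dV0 : 0 < d^-1 by rewrite invr_gt0; exact: lt_le_trans d1.
have AE1 : 0 < 4 * (A * E + 1) by rewrite mulr_gt0 // ltr_wpDl // mulr_ge0.
pose s := Num.min ((1 - eta) / 2 * d^-1) (eps / (4 * (A * E + 1))).
have s0 : 0 < s.
  rewrite lt_min (divr_gt0 eps0 AE1) andbT; apply: mulr_gt0 dV0.
  by rewrite divr_gt0 // subr_gt0.
have sr j : s <= (1 - eta) / 2 * r 0 j.
  apply: (@le_trans _ _ ((1 - eta) / 2 * d^-1)); first by rewrite ge_min lexx.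
  by rewrite ler_wpM2l // divr_ge0 // subr_ge0 ltW.
have sAE : 2 * (s * (A * E)) <= eps / 2.
  have : s * (4 * (A * E + 1)) <= eps by rewrite -ler_pdivlMr // ge_min lexx orbT.
  have := mulr_ge0 A0 E0; lra.
pose eps' := Num.min eps (eps * s / 8).
have eps'0 : 0 < eps' by rewrite lt_min eps0 divr_gt0 // mulr_gt0.
have eps'1 : eps' <= eps by rewrite ge_min lexx.
have eps's : 4 * eps' / s <= eps / 2.
  rewrite ler_pdivrMr //; have : eps' <= eps * s / 8 by rewrite ge_min lexx orbT.
  lra.
pose eta' := (1 + eta) / 2.
have eta'1 : eta' < 1 by rewrite /eta'; lra.
have etaeta' : eta <= eta' by rewrite /eta'; lra.
have eta'0 : 0 < eta' by rewrite /eta'; lra.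
have [|D D0 HD] := IH (ltnW km) eps' eta' eps'0; first by rewrite eta'0.
exists (D + 4 * D / s); first by rewrite addr_ge0 // divr_ge0 ?mulr_ge0 // ltW.
move=> z0 M z0B FM K z Kk zr.
have l0 := weight_gt0 z0B.
have rl0 j : 0 <= r 0 j / L z0 0 j by rewrite divr_ge0 ?ltW.
have zr' : polydisc z0 (eta' *: vdiv r (L z0)) z.
  by apply: polydiscS zr => j; rewrite !mxE ler_wpM2r.
have M0 : 0 <= M.
  apply: le_trans (normc_ge0 (F z0)) _; apply: FM; apply: polydisc_center => j.
  by rewrite mxE.
set N := nsize _ _; have N0 : 0 <= N by exact: nsize_ge0.
have DsM : 0 <= 4 * D / s * M by rewrite mulr_ge0 // divr_ge0 ?mulr_ge0 // ltW.
move: Kk; rewrite leq_eqVlt ltnS => /orP[/eqP KS|Kk]; last first.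
  apply: le_trans (HD z0 M z0B FM K z Kk zr') _.
  have : eps' * N <= eps * N by rewrite ler_wpM2r.
  rewrite -/N; lra.
have [K' [j KE]] : exists K' j, K = incr_midx K' j by apply: midx_incr_ex; rewrite KS.
have K'k : mdeg K' = k by move: KS; rewrite KE mdeg_incr => -[].
pose c (t : R) := shift_coord z j (t%:C * (1 / (L z0 0 j)%:C)).
have cr t : 0 <= t <= s -> polydisc z0 (eta' *: vdiv r (L z0)) (c t).
  move=> /andP[t0 ts] i; have := zr i; have := zr' i.
  rewrite /c shift_coordE; case: eqP => [->|_]; last by rewrite mulr0 addr0.
  rewrite mulr1 !mxE => _ h; rewrite addrAC; apply: le_trans (le_normcD _ _) _.
  have -> : normc (t%:C * (1 / (L z0 0 j)%:C)) = t / L z0 0 j.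
    by rewrite normcM normc_real ger0_norm // mul1r normcV normc_real gtr0_norm.
  apply: le_trans (lerD h (lexx _)) _; rewrite !mulrA -mulrDl ler_wpM2r ?invr_ge0 ?(ltW (l0 j)) //.
  by have := sr j; rewrite /eta'; lra.
have cr1 t : 0 <= t <= s -> polydisc z0 (vdiv r (L z0)) (c t).
  by move=> /cr; apply: scaled => //; exact: ltW.
have cB t : 0 <= t <= s -> unit_ball (c t).
  by move=> /cr1; exact: (weighted_polydisc_sub_ball z0B rn rb).
have der K'' t : 0 <= t <= s ->
    cderive (fun t => nderiv (L z0) K'' (c t)) t (nderiv (L z0) (incr_midx K'' j) (c t)).
  move=> /cB ctB; have := cderive_nderiv Fan K'' l0 ctB.
  by rewrite [X in cderive _ _ X]mul1r.
have := @complex_landau R (fun t => nderiv (L z0) K' (c t)) (fun t => nderiv (L z0) K (c t))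
  (fun t => nderiv (L z0) (incr_midx K j) (c t)) s (D * M + eps' * N) (A * (E * N)) s0.
have -> : c 0 = z by rewrite /c mul0r shift_coord0.
move=> landau; apply: le_trans (landau _ _ _ _) _.
- by move=> t /der; rewrite KE; apply.
- by move=> t /der; apply.
- by move=> t ts; apply: HD => //; [rewrite K'k|exact: cr].
- move=> t ts; apply: le_trans (HA z0 _ z0B (cr1 t ts) _ _) _.
    by rewrite mdeg_incr KS ltnS.
  exact: (ler_wpM2l A0 (HE _ _ z0B (cr1 t ts))).
have : 2 * (s * (A * E)) * N <= eps / 2 * N by rewrite ler_wpM2r.
have : 4 * eps' / s * N <= eps / 2 * N by rewrite ler_wpM2r.
have : 0 <= D * M by rewrite mulr_ge0.
have -> : 2 * (2 * (D * M + eps' * N) / s + s * (A * (E * N))) =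
  4 * D / s * M + 4 * eps' / s * N + 2 * (s * (A * E)) * N by ring.
lra.
Qed.

(** [interpolation] with eps so small that the multiples of N(z0) on the right add up
    to N(z0) / 2. *)
Lemma nsize_center_le r : (forall j, 0 < r 0 j) -> vnorm r < beta ->
  exists2 D : R, 0 <= D & forall z0 (M : R), unit_ball z0 ->
    (forall z, polydisc z0 (vdiv r (L z0)) z -> normc (F z) <= M) ->
    nsize (L z0) z0 <= D * M.
Proof.
move=> r0 rb; pose k : R := #|{ffun 'I_n -> 'I_m.+1}|%:R + 1.
have k0 : 0 < k by rewrite ltr_wpDl // ler0n.
have [||D D0 HD] := interpolation r0 rb (leqnn m) (eps := (2 * k)^-1) (eta := 2^-1).
- by rewrite invr_gt0 mulr_gt0.
- by rewrite invr_gt0 ltr0n /= invf_lt1 // ltr1n.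
exists (2 * k * D); first by rewrite !mulr_ge0 // ltW.
move=> z0 M z0B FM.
have l0 := weight_gt0 z0B.
have rl0 j : 0 <= r 0 j / L z0 0 j by rewrite divr_ge0 ?ltW.
have M0 : 0 <= M.
  apply: le_trans (normc_ge0 (F z0)) _; apply: FM; apply: polydisc_center => j.
  by rewrite mxE.
have N0 : 0 <= nsize (L z0) z0 by exact: nsize_ge0.
have x0 : 0 <= D * M + (2 * k)^-1 * nsize (L z0) z0.
  by rewrite addr_ge0 ?mulr_ge0 // invr_ge0 mulr_ge0 // ltW.
have := nsize_le (F := F) (l := L z0) (z := z0) x0.
have H K : (mdeg K <= m)%N -> normc (nderiv (L z0) K z0) <= D * M + (2 * k)^-1 * nsize (L z0) z0.
  move=> Km; apply: HD => //; apply: polydisc_center => j.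
  by rewrite !mxE mulr_ge0 // invr_ge0.
move=> /(_ m H); rewrite -/k mulrDr.
have -> : k * ((2 * k)^-1 * nsize (L z0) z0) = nsize (L z0) z0 / 2.
  by field; rewrite gt_eqF.
lra.
Qed.

End BoundedIndex.

(** * Comparison of maxima over two tori *)

Theorem theorem5 (R : realType) (n : nat) (n_gt0 : (0 < n)%N)
    (beta : R) (beta_gt : Num.sqrt n%:R < beta)
    (L : 'rV[R[i]]_n -> 'rV[R]_n) (LQ : classQ beta L)
    (F : 'rV[R[i]]_n -> R[i]) (Fan : analytic_on_ball F)
    (Fidx : bounded_index L F)
    (r' r'' : 'rV[R]_n)
    (r'_pos : forall j, 0 < r' 0 j) (r''_ge0 : nonneg_vec r'')
    (norm_r'_gt0 : 0 < vnorm r') (norm_r'_lt : vnorm r' < vnorm r'')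
    (norm_r''_lt : vnorm r'' < beta) :
  exists p1 : R, 1 <= p1 /\
    forall z0 : 'rV[R[i]]_n, unit_ball z0 ->
      max_torus (vdiv r'' (L z0)) z0 F <= p1 * max_torus (vdiv r' (L z0)) z0 F.
Proof.
have beta0 : 0 < beta by apply: le_lt_trans beta_gt; exact: sqrtr_ge0.
have [m Fm] := Fidx.
have r'b : vnorm r' < beta := lt_trans norm_r'_lt norm_r''_lt.
have r'0 : nonneg_vec r' by move=> j; exact: ltW.
have [D D0 HD] := nsize_center_le beta0 LQ Fan Fm r'_pos r'b.
have [E' E'0 HE'] := nsize_polydisc beta0 LQ Fan Fm r'0 r'b.
have [E E0 HE] := nsize_polydisc beta0 LQ Fan Fm r''_ge0 norm_r''_lt.
exists (1 + E * D); split=> [|z0 z0B]; first by rewrite lerDl mulr_ge0.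
have l0 := weight_gt0 beta0 LQ z0B.
have ge0 r : nonneg_vec r -> nonneg_vec (vdiv r (L z0)).
  by move=> r0 j; rewrite mxE divr_ge0 ?r0 // ltW.
have F_le_nsize z : normc (F z) <= nsize (F := F) m (L z0) z.
  rewrite -(@nderiv0 _ _ F (L z0) [ffun=> 0%N]); last first.
    by rewrite /mdeg big1 // => j _; rewrite ffunE.
  by apply: nderiv_le_nsize; rewrite /mdeg big1 // => j _; rewrite ffunE.
set M := max_torus (vdiv r' (L z0)) z0 F.
(* The estimate from above, on the polydisc of R', bounds F on its torus, so that
   the supremum M is finite. *)
have torM z : torus z0 (vdiv r' (L z0)) z -> normc (F z) <= M.
  apply: (le_max_torus (B := E' * nsize (F := F) m (L z0) z0)) => {}z /torus_polydisc zr.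
  exact: le_trans (F_le_nsize z) (HE' _ _ z0B zr).
have discM := maximum_modulus_torus Fan (weighted_polydisc_sub_ball LQ z0B r'0 r'b) torM.
have M0 : 0 <= M.
  apply: le_trans (normc_ge0 (F z0)) (discM z0 _).
  by apply: polydisc_center; exact: ge0.
apply: max_torus_le; first exact: ge0.
move=> z /torus_polydisc zr.
apply: le_trans (F_le_nsize z) _; apply: le_trans (HE _ _ z0B zr) _.
apply: le_trans (ler_wpM2l E0 (HD _ _ z0B discM)) _.
by rewrite mulrDl mul1r mulrA lerDr.
Qed.
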